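(* Let $d_{i,j}\in[0,1]$, $(i,j)\in\{-1,0,1\}^2$, be weights with $\sum_{(i,j)}d_{i,j}=1$, let $t\in\,]0,1[$ be transcendental over $\mathbb{Q}(d_{i,j})$, and let $\mathcal{S}=\{(i,j): d_{i,j}\neq0\}$ be the step set. (1) The nondegenerate models of walks of genus zero are the nondegenerate models whose step set is included in a closed half plane of $\mathbb{R}^2$ whose boundary passes through $(0,0)$. More precisely, they are the nondegenerate models satisfying one of the following: (a) $d_{-1,1}\neq0$, $d_{1,-1}\neq0$ and $d_{-1,-1}=d_{-1,0}=d_{0,-1}=0$; (b) $d_{1,1}\neq0$, $d_{-1,-1}\neq0$ and $d_{-1,0}=d_{-1,1}=d_{0,1}=0$; (c) $d_{-1,1}\neq0$, $d_{1,-1}\neq0$ and $d_{1,1}=d_{1,0}=d_{0,1}=0$; (d) $d_{1,1}\neq0$, $d_{-1,-1}\neq0$ and $d_{1,0}=d_{1,-1}=d_{0,-1}=0$. (2) The nondegenerate models of walks of genus one are the models whose step set is not included in any closed half plane of $\mathbb{R}^2$ whose boundary passes through $(0,0)$.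
   Context: The kernel polynomial is $K(x,y,t)=xy\big(1-t\sum_{i,j}d_{i,j}x^iy^j\big)\in\mathbb{C}[x,y]$. The model is degenerate if $K(x,y,t)$ is reducible in $\mathbb{C}[x,y]$, or has $x$-degree $\le1$, or has $y$-degree $\le1$; otherwise it is nondegenerate. The kernel curve is $$\overline{E_t}=\{([x_0:x_1],[y_0:y_1])\in\mathbb{P}^1(\mathbb{C})\times\mathbb{P}^1(\mathbb{C}) : \overline{K}(x_0,x_1,y_0,y_1,t)=0\},$$ where $\overline{K}(x_0,x_1,y_0,y_1,t)=x_0x_1y_0y_1-t\sum_{i,j=0}^2 d_{i-1,j-1}x_0^ix_1^{2-i}y_0^jy_1^{2-j}$. The genus of a nondegenerate model is the (geometric) genus of the irreducible curve $\overline{E_t}$. *)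

(* Defs.v *)
From mathcomp Require Import all_boot all_order all_algebra.
From mathcomp Require Import boolp classical_sets reals.
From mathcomp Require Import complex.

Set Implicit Arguments.
Unset Strict Implicit.
Unset Printing Implicit Defensive.

Import Order.TTheory GRing.Theory Num.Theory.

Local Open Scope classical_set_scope.
Local Open Scope ring_scope.

(** * Function fields and geometric genus of curves in P^1 x P^1 *)

(* A point of P^1 x P^1 is given by homogeneous coordinates
   ((x0, x1), (y0, y1)) with (x0, x1) <> (0, 0) and (y0, y1) <> (0, 0);
   a subset of P^1 x P^1 is given by the set of all the homogeneous
   coordinates of its points. *)
Definition P1xP1_coord (k : fieldType) : Type := (k * k) * (k * k).

Definition in_P1xP1 (k : fieldType) (p : P1xP1_coord k) : Prop :=
  p.1 <> (0, 0) /\ p.2 <> (0, 0).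

(* Value at p of the bihomogeneous polynomial of bidegree (m, n)
   \sum_(i, j) g_ij x0^i x1^(m-i) y0^j y1^(n-j). *)
Definition bihom_eval (k : fieldType) (m n : nat)
    (g : 'M[k]_(m.+1, n.+1)) (p : P1xP1_coord k) : k :=
  \sum_(i < m.+1) \sum_(j < n.+1)
    g i j * p.1.1 ^+ i * p.1.2 ^+ (m - i) * p.2.1 ^+ j * p.2.2 ^+ (n - j).

Section Genus.
Variables (k F : fieldType) (iota : {rmorphism k -> F}).

(* F is the function field of V, an irreducible closed subset of P^1 x P^1:
   p is the generic point of V, i.e. the bihomogeneous polynomials over k that
   vanish at p are those that vanish on V, and F is the set of the values at p
   of the rational functions g / h, with g and h bihomogeneous of the same
   bidegree. *)
Definition is_function_field (V : set (P1xP1_coord k)) : Prop :=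
  exists p : P1xP1_coord F,
    [/\ in_P1xP1 p,
        forall m n (g : 'M[k]_(m.+1, n.+1)),
          bihom_eval (map_mx iota g) p = 0 <->
          (forall q, V q -> bihom_eval g q = 0)
      & forall f : F, exists m n (g h : 'M[k]_(m.+1, n.+1)),
          bihom_eval (map_mx iota h) p <> 0 /\
          f = bihom_eval (map_mx iota g) p / bihom_eval (map_mx iota h) p].

(* For F a function field of one variable over k, the valuation rings of F / k
   are the local rings of the points of its nonsingular projective model. *)
Definition valuation_ring (O : {pred F}) : Prop :=
  [/\ GRing.subring_closed O,
      forall c : k, iota c \in O,
      exists f : F, f \notin O
    & forall f : F, f \in O \/ f^-1 \in O].

Record derivation := Derivation {
  der_fun :> F -> F;
  derD : forall x y, der_fun (x + y) = der_fun x + der_fun y;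
  derM : forall x y, der_fun (x * y) = x * der_fun y + y * der_fun x;
  derC : forall c, der_fun (iota c) = 0 }.

(* The F-vector space Omega_{F/k} of Kaehler differentials embeds into its
   bidual, and its dual is the space of k-derivations of F. A differential
   \sum a db is thus encoded as the function D |-> \sum a D(b). For a subring A
   of F containing k, this predicate describes the image of Omega_{A/k} in
   Omega_{F/k}. *)
Definition differential_over (A : {pred F}) (w : derivation -> F) : Prop :=
  exists s : seq (F * F),
    (forall ab, ab \in s -> ab.1 \in A /\ ab.2 \in A) /\
    (forall D : derivation, w D = \sum_(ab <- s) ab.1 * D ab.2).

Definition regular_differential (w : derivation -> F) : Prop :=
  differential_over predT w /\
  (forall O : {pred F}, valuation_ring O -> differential_over O w).

(* The k-vector space of everywhere regular differentials has dimension g. *)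
Definition field_genus (g : nat) : Prop :=
  exists w : 'I_g -> derivation -> F,
    [/\ forall i, regular_differential (w i),
        forall c : 'I_g -> k,
          (forall D, \sum_(i < g) iota (c i) * w i D = 0) -> forall i, c i = 0
      & forall u, regular_differential u ->
          exists c : 'I_g -> k,
            forall D, u D = \sum_(i < g) iota (c i) * w i D].

End Genus.

(* The geometric genus of the irreducible curve V is g. The function field is
   unique up to k-isomorphism. *)
Definition geometric_genus (k : fieldType) (V : set (P1xP1_coord k)) (g : nat)
    : Prop :=
  exists (F : fieldType) (iota : {rmorphism k -> F}),
    is_function_field iota V /\ field_genus iota g.

(** * Reducibility in k[x, y] *)

Definition reducible (A : unitRingType) (p : A) : Prop :=
  exists u v : A,
    [/\ u \isn't a GRing.unit, v \isn't a GRing.unit & p = u * v].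

(** * Transcendence over a generated subfield *)

Definition transcendental_over (R : fieldType) (A : set R) (t : R) : Prop :=
  forall p : {poly R}, (forall i, A p`_i) -> root p t -> p = 0.

(** * Weighted models of walks with small steps *)

(* The nine weights are d i j with i and j in {-1, 0, 1}; the other values
   of d are never used. *)
Definition step_range : seq int := [:: -1; 0; 1].

Section Model.
Variable R : realType.
Implicit Types (d : int -> int -> R) (t : R).

(* Q(d_{i,j}), the smallest subfield of R containing the nine weights. *)
Definition weight_field d : set R :=
  [set x | forall S : {pred R}, GRing.divring_closed S ->
     (forall i j, i \in step_range -> j \in step_range -> d i j \in S) ->
     x \in S].

Definition step_set d : set (int * int) :=
  [set ij | [/\ ij.1 \in step_range, ij.2 \in step_range & d ij.1 ij.2 != 0]].

(* S is included in a closed half plane of R^2 whose boundary passes through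
   the origin. *)
Definition in_half_plane (S : set (int * int)) : Prop :=
  exists a b : R, (a, b) <> (0, 0) /\
    (forall i j : int, S (i, j) -> 0 <= a * i%:~R + b * j%:~R).

(* K(x, y, t) = xy - t \sum_(i, j) d_{i-1,j-1} x^i y^j, with x = 'X the outer
   variable and y = 'Y the inner one. *)
Definition kernel_poly d t : {poly {poly R[i]}} :=
  'X * 'Y - (t%:C%C)%:P%:P *
    \sum_(i < 3) \sum_(j < 3)
      ((d (i%:Z - 1) (j%:Z - 1))%:C%C)%:P%:P * 'X^i * 'Y ^+ j.

Definition degenerate_model d t : Prop :=
  [\/ reducible (kernel_poly d t),
      ((size (kernel_poly d t)).-1 <= 1)%N
    | ((sizeY (kernel_poly d t)).-1 <= 1)%N].

Definition nondegenerate_model d t : Prop := ~ degenerate_model d t.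

Definition kernel_form d t (x0 x1 y0 y1 : R[i]) : R[i] :=
  x0 * x1 * y0 * y1 - t%:C%C *
    \sum_(i < 3) \sum_(j < 3)
      (d (i%:Z - 1) (j%:Z - 1))%:C%C *
        x0 ^+ i * x1 ^+ (2 - i) * y0 ^+ j * y1 ^+ (2 - j).

Definition kernel_curve d t : set (P1xP1_coord R[i]) :=
  [set p | in_P1xP1 p /\ kernel_form d t p.1.1 p.1.2 p.2.1 p.2.2 = 0].

(* Only meaningful for nondegenerate models. *)
Definition model_genus d t (g : nat) : Prop :=
  geometric_genus (kernel_curve d t) g.

End Model.

(* Main.v *)
From HB Require Import structures.
Require Import Defs.
From mathcomp Require Import all_boot all_order all_algebra all_field.
From mathcomp Require Import boolp classical_sets reals.
From mathcomp Require Import complex.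
From mathcomp Require Import ring lra.

(** The kernel is a quadratic polynomial [K = c x^2 + b x + a] in [x] over
    [k[y]], with [k] the complex numbers, and its function field is
    [F = k(y)(x)].  A function field of the curve is the same thing as a field
    generated over [k] by elements [x] and [y] such that [y] is transcendental,
    [x] is not in [k(y)] and [K(x, y) = 0] (kernel_field_function_field,
    generic_kernel_field), and such a field exists when [K] is irreducible.
    Hence the genus can be computed in any such field, and no comparison of two
    function fields is needed: a genus zero field has no nonzero regular
    differential and a genus one field has one (genus01_absurd).

    Steps in a half plane.  A nondegenerate model has a step on each side of the
    square, so that the normal vector has nonzero coordinates; the boundary of the
    half plane can then be turned until it passes through two opposite corners.
    Reversing the directions of the axes, that is replacing [x] or [y] by its
    inverse, leaves the case where [K] has no term of degree less than two.  Then the curve has a double point at the origin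
    and becomes a conic in the coordinates [y / x] and [y]; the pencil of lines
    through a point of the conic parametrises it, so that [F = k(m)]
    (double_point_genus0).  On [k(m)] a regular differential is [f dm] with [f] a
    polynomial in [m], and in the same way it is [g d(1/m)] with [g] a polynomial
    in [1/m]; this forces [f = 0].

    Steps in no half plane.  Put [eta = 2 c x + b], so that [eta^2] is the
    discriminant [Delta(y) = b^2 - 4 a c], of degree at most 4.  The weights are
    nonnegative and [t < 1], therefore [Delta] is positive at [1] and [-1] and
    takes a negative value between them, and so has two roots in the interval
    from [-1] to [1]; the reversed weights give two more outside (two_roots).
    So [Delta], with a root at infinity if its degree is 3, has four distinct
    roots.  This makes [K] irreducible (separable_irreducible).  It also makes
    [w = dy / eta] regular: if [U Delta + V Delta' = 1], then
    [w = U eta dy + 2 V d eta], which has coefficients in every valuation ring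
    containing [y], and a valuation ring that does not contain [y] contains
    [1 / y], where the same formula applies to the reversed discriminant.
    Conversely a regular differential is [(P + Q eta) w] with [P] and [Q]
    polynomials in [y], because it is regular at the points of the affine curve
    [eta^2 = Delta(y)]; the chart at infinity leaves only constants
    (double_cover_genus1). *)

Set Implicit Arguments.
Unset Strict Implicit.
Unset Printing Implicit Defensive.

Import Order.TTheory GRing.Theory Num.Theory.
Local Open Scope ring_scope.

(** * Reversed polynomials *)

Section Reversal.
Variable K : fieldType.
Implicit Types (x : K) (p : {poly K}).

(** Change of chart [x -> 1 / x] on forms of degree [n]: a polynomial [p]
    of degree at most [n] becomes [x^n p(1 / x)]. *)
Definition revp n p : {poly K} := \poly_(i < n.+1) p`_(n - i).

Lemma horner_revp x n p : x != 0 -> (size p <= n.+1)%N ->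
  (revp n p).[x] = x ^+ n * p.[x^-1].
Proof.
move=> x0 sp; rewrite (horner_coef_wide _ (size_poly _ _)) (horner_coef_wide _ sp).
rewrite big_distrr /= (reindex_inj rev_ord_inj) /=; apply: eq_bigr => i _.
have lin : (i <= n)%N by rewrite -ltnS.
rewrite coef_poly subSS ltnS leq_subr subKn //.
have -> : x ^+ n = x ^+ i * x ^+ (n - i) by rewrite -exprD subnKC.
by rewrite exprVn; field; apply: expf_neq0.
Qed.

Lemma revpK n p : (size p <= n.+1)%N -> revp n (revp n p) = p.
Proof.
move=> sp; apply/polyP=> i; rewrite !coef_poly !ltnS leq_subr.
case: leqP => [lin|lti]; first by rewrite subKn.
by rewrite nth_default // (leq_trans sp).
Qed.

Lemma revp_neq0 n p : (size p <= n.+1)%N -> p != 0 -> revp n p != 0.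
Proof.
move=> sp; apply: contraNneq => r0; rewrite -(revpK sp) r0; apply/eqP/polyP=> i.
by rewrite coef_poly !coef0 if_same.
Qed.

End Reversal.

Lemma map_revp (K L : fieldType) (f : {rmorphism K -> L}) n p :
  map_poly f (revp n p) = revp n (map_poly f p).
Proof.
apply/polyP=> i; rewrite coef_map /= [in LHS]coef_poly [RHS]coef_poly coef_map.
by case: ifP => // _; rewrite rmorph0.
Qed.

(** * Subfields of rational functions *)

Section Generation.
Variables (k F : fieldType) (iota : {rmorphism k -> F}).
Implicit Types (P : F -> Prop) (x y f g : F) (p q : {poly k}).

Definition peval x : {poly k} -> F := horner_eval x \o map_poly iota.

HB.instance Definition _ x :=
  GRing.RMorphism.copy (peval x) (horner_eval x \o map_poly iota).

Lemma pevalC x c : peval x c%:P = iota c.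
Proof. by rewrite /peval /= map_polyC /horner_eval hornerC. Qed.

Lemma pevalX x : peval x 'X = x.
Proof. by rewrite /peval /= map_polyX /horner_eval hornerX. Qed.

Lemma pevalZ x c p : peval x (c *: p) = iota c * peval x p.
Proof. by rewrite -mul_polyC rmorphM /= pevalC. Qed.

Lemma pevalE x p n : (size p <= n)%N ->
  peval x p = \sum_(i < n) iota p`_i * x ^+ i.
Proof.
move=> sp; rewrite /peval /= /horner_eval (@horner_coef_wide _ n).
  by apply: eq_bigr => i _; rewrite coef_map.
by rewrite (leq_trans _ sp) // size_poly.
Qed.

Definition transcendental x := forall p, peval x p = 0 -> p = 0.

(** Predicates in Prop stand for intermediate fields between [k] and [F], so that
    the field generated by given elements can be handled by its universal
    property. *)
Definition subfield P := [/\ forall c, P (iota c),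
  forall f g, P f -> P g -> P (f + g),
  forall f g, P f -> P g -> P (f * g) & forall f, P f -> P f^-1].

Definition rational_in x f :=
  exists p q, peval x q != 0 /\ f = peval x p / peval x q.

Definition generated_by x y :=
  forall P, subfield P -> P x -> P y -> forall f, P f.

Lemma subfieldX P x n : subfield P -> P x -> P (x ^+ n).
Proof.
case=> PC _ PM _ Px; elim: n => [|n IHn]; last by rewrite exprS; apply: PM.
by rewrite expr0 -(rmorph1 iota).
Qed.

Lemma subfield_sum P (I : Type) (r : seq I) (G : I -> F) :
  subfield P -> (forall i, P (G i)) -> P (\sum_(i <- r) G i).
Proof.
case=> PC PD _ _ PG; apply: (big_ind P) => //.
by rewrite -(rmorph0 iota).
Qed.

Lemma subfieldN P f : subfield P -> P f -> P (- f).
Proof.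
by case=> PC _ PM _ Pf; rewrite -mulN1r; apply: PM; rewrite // -(rmorphN1 iota).
Qed.

Lemma subfield_peval P x p : subfield P -> P x -> P (peval x p).
Proof.
move=> sP Px; have [PC _ PM _] := sP.
rewrite (pevalE x (leqnn _)); apply: subfield_sum => // i.
by apply: PM => //; apply: subfieldX.
Qed.

Lemma rational_in_min P x f : subfield P -> P x -> rational_in x f -> P f.
Proof.
move=> sP Px [p [q [_ ->]]]; have [_ _ PM PV] := sP.
by apply: PM; [|apply: PV]; apply: subfield_peval.
Qed.

Lemma rational_in_peval x p : rational_in x (peval x p).
Proof. by exists p, 1; rewrite rmorph1 oner_eq0 divr1. Qed.

Lemma rational_in_self x : rational_in x x.
Proof. by rewrite -{2}(pevalX x); apply: rational_in_peval. Qed.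

Lemma rational_in_subfield x : subfield (rational_in x).
Proof.
split.
- by move=> c; rewrite -(pevalC x); apply: rational_in_peval.
- move=> f g [p [q [q0 ->]]] [p' [q' [q'0 ->]]].
  exists (p * q' + p' * q), (q * q'); rewrite !rmorphD !rmorphM mulf_neq0 //.
  by split=> //; field; rewrite q0 q'0.
- move=> f g [p [q [q0 ->]]] [p' [q' [q'0 ->]]].
  exists (p * p'), (q * q'); rewrite !rmorphM mulf_neq0 //.
  by split=> //; field; rewrite q0 q'0.
- move=> f [p [q [q0 ->]]]; have [->|p0] := eqVneq (peval x p) 0.
    by exists 0, 1; rewrite !rmorph0 rmorph1 oner_eq0 mul0r invr0 mul0r.
  by exists q, p; split; rewrite // invf_div.
Qed.

(** If [h] were nonzero, [e = - g / h] would be a rational function of [x]. *)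
Lemma rational_free x e g h : ~ rational_in x e -> rational_in x g ->
  rational_in x h -> g + h * e = 0 -> g = 0 /\ h = 0.
Proof.
have sub := rational_in_subfield x; have [_ _ PM PV] := sub.
move=> eN rg rh E; have [h0|h0] := eqVneq h 0.
  by split=> //; move: E; rewrite h0 mul0r addr0.
case: eN; have -> : e = - g * h^-1.
  by apply: (mulIf h0); rewrite divfK // mulrC; apply/eqP; rewrite -addr_eq0 addrC E.
by apply: PM; [exact: (subfieldN sub) | exact: PV].
Qed.

Lemma rational_in_trans x y f :
  rational_in x y -> rational_in y f -> rational_in x f.
Proof. by move=> xy; apply: rational_in_min => //; apply: rational_in_subfield. Qed.

Lemma rational_inV x : rational_in x x^-1.
Proof.
have [_ _ _ PV] := rational_in_subfield x.
by apply: PV; apply: rational_in_self.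
Qed.

Lemma rational_inVE x f : rational_in x^-1 f <-> rational_in x f.
Proof.
split; apply: rational_in_trans; first exact: rational_inV.
by rewrite -{2}(invrK x); apply: rational_inV.
Qed.

Lemma rational_in_reduce x f : transcendental x -> rational_in x f ->
  exists p q, [/\ q != 0, coprimep p q & f = peval x p / peval x q].
Proof.
move=> tx [p [q [q0 ->]]].
have qN0 : q != 0 by apply: contraNneq q0 => ->; rewrite rmorph0.
have gN0 : gcdp p q != 0 by rewrite gcdp_eq0 negb_and qN0 orbT.
have Ep := divpK (dvdp_gcdl p q); have Eq := divpK (dvdp_gcdr p q).
exists (p %/ gcdp p q), (q %/ gcdp p q); split.
- by rewrite divp_eq0 negb_or negb_or qN0 gN0 /= -leqNgt leq_gcdpr.
- by rewrite coprimep_div_gcd // qN0 orbT.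
- have gx0 : peval x (gcdp p q) != 0 by apply: contraNneq gN0 => /tx ->.
  have Ep' := congr1 (peval x) Ep; have Eq' := congr1 (peval x) Eq.
  move: q0; rewrite -Ep' -Eq' !rmorphM /= mulf_eq0 negb_or => /andP[q1 _].
  by field; rewrite q1 gx0.
Qed.

Lemma transcendental_neq0 x p : transcendental x -> p != 0 -> peval x p != 0.
Proof. by move=> tx; apply: contraNneq => /tx ->. Qed.

Lemma transcendental_inj x p q :
  transcendental x -> peval x p = peval x q -> p = q.
Proof.
by move=> tx /eqP; rewrite -subr_eq0 -rmorphB => /eqP/tx/eqP; rewrite subr_eq0 => /eqP.
Qed.

Lemma transcendental_self_neq0 x : transcendental x -> x != 0.
Proof. by move/transcendental_neq0=> /(_ _ (negbT (polyX_eq0 _))); rewrite pevalX. Qed.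

Lemma peval_revp x n p : x != 0 -> (size p <= n.+1)%N ->
  peval x (revp n p) = x ^+ n * peval x^-1 p.
Proof.
move=> x0 sp; rewrite /peval /= /horner_eval map_revp horner_revp //.
by rewrite size_map_poly.
Qed.

Lemma transcendentalV x : transcendental x -> transcendental x^-1.
Proof.
move=> tx p p0; have x0 := transcendental_self_neq0 tx.
have /tx/polyP r0 : peval x (revp (size p) p) = 0.
  by rewrite peval_revp ?p0 ?mulr0.
apply/polyP=> i; rewrite coef0; case: (ltnP i (size p)) => hi; last by rewrite nth_default.
have := r0 (size p - i)%N; rewrite coef0 coef_poly ltnS leq_subr subKn //.
exact: ltnW.
Qed.

(** Both sides are polynomials, one in [x] and one in [1 / x]; comparing degrees,
    the left one cannot have positive degree.  This is how a differential that is
    polynomial in both charts of the line is shown to be constant or zero. *)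
Lemma peval_eqV x p q j : transcendental x ->
  peval x p * x ^+ j = peval x^-1 q -> (size p <= 1)%N /\ ((0 < j)%N -> p = 0).
Proof.
move=> tx E; have x0 := transcendental_self_neq0 tx.
have Epq : p * 'X^(j + size q) = revp (size q) q.
  apply: (transcendental_inj tx).
  by rewrite rmorphM rmorphXn /= pevalX peval_revp // -E exprD; ring.
have Hc i : (p`_i != 0) -> (i + j <= 0)%N.
  move=> pi; have : (p * 'X^(j + size q))`_(i + j + size q) != 0.
    by rewrite coefMXn -addnA ltnNge leq_addl addnK.
  rewrite Epq coef_poly; case: ifP => [|_]; last by rewrite eqxx.
  by rewrite ltnS -[X in (_ <= X)%N -> _]add0n leq_add2r.
split; last first.
  move=> j0; apply/polyP=> i; rewrite coef0; apply/eqP/negbNE/negP=> /Hc.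
  by rewrite leqNgt addn_gt0 j0 orbT.
apply/leq_sizeP=> i i0; apply/eqP/negbNE/negP=> /Hc.
by rewrite leqNgt addn_gt0 i0.
Qed.

End Generation.

(** * Derivations and differentials *)

Section Derivations.
Variables (k F : fieldType) (iota : {rmorphism k -> F}).
Implicit Types (D : derivation iota) (f g : F).

Lemma der1 D : D 1 = 0.
Proof. by rewrite -(rmorph1 iota) derC. Qed.

Lemma der0 D : D 0 = 0.
Proof. by rewrite -{1}(rmorph0 iota) derC. Qed.

Lemma derV D f : f != 0 -> D f^-1 = - D f / f ^+ 2.
Proof.
move=> f0; have := der1 D; rewrite -(divff f0) derM => E.
have -> : D f^-1 = (f * D f^-1 + f^-1 * D f - f^-1 * D f) / f by field.
by rewrite E; field.
Qed.

Lemma der_div D f g : g != 0 -> D (f / g) = (g * D f - f * D g) / g ^+ 2.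
Proof. by move=> g0; rewrite derM derV //; field. Qed.

Lemma der_peval D x p : D (peval iota x p) = peval iota x p^`() * D x.
Proof.
elim/poly_ind: p => [|p c IHp].
  by rewrite deriv0 !rmorph0 mul0r der0.
rewrite derivMXaddC !rmorphD !rmorphM /= !pevalX pevalC derD derM derC IHp.
by ring.
Qed.

(** When every differential [db] with [b] in [O] is a multiple of [om] by an
    element of [O], the differentials over [O] are the multiples of [om] by the
    elements of [O]. *)
Lemma differential_over_ring (O : {pred F}) (om : derivation iota -> F) u :
  GRing.subring_closed O ->
  (forall b, b \in O -> exists2 b', b' \in O & forall D, D b = b' * om D) ->
  differential_over O u -> exists2 f, f \in O & forall D, u D = f * om D.
Proof.
move=> [O1 OB OM] Oom [s [sO us]].
have O0 : 0 \in O by rewrite -(subrr 1) OB.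
have ON f : f \in O -> - f \in O by move=> fO; rewrite -sub0r OB.
suff [f fO Ef] : exists2 f, f \in O &
    forall D, \sum_(ab <- s) ab.1 * D ab.2 = f * om D.
  by exists f => // D; rewrite us.
elim: s sO {u us} => [|[a b] s IHs] sO.
  by exists 0 => // D; rewrite big_nil mul0r.
have [|f fO Ef] := IHs; first by move=> ab ?; apply: sO; rewrite inE orbC; apply/orP; left.
have [/= aO bO] := sO (a, b) (mem_head _ _).
have [b' b'O Eb] := Oom _ bO.
exists (a * b' + f); last by move=> D; rewrite big_cons /= Ef Eb; ring.
by rewrite -(opprK f) OB ?OM // ON.
Qed.

End Derivations.

(** * Local rings of points *)

Section LocalRing.
Variables (k F : fieldType) (iota : {rmorphism k -> F}) (S : comNzRingType).
Variables (phi : {rmorphism S -> F}) (psi : {rmorphism S -> k}).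
Hypothesis ker_phi : forall s, phi s = 0 -> psi s = 0.
Implicit Types (f : F) (g h s : S) (z : int).

(** A point of a curve is given by a ring [S] of functions, with [phi]
    sending them to the function field and [psi] to their values at the point.
    Different elements of [S] may give the same function, provided that they have
    the same value. *)
Definition local_ring : {pred F} :=
  [pred f | `[< exists g h, psi h != 0 /\ f = phi g / phi h >]].

Lemma local_ringP f :
  reflect (exists g h, psi h != 0 /\ f = phi g / phi h) (f \in local_ring).
Proof. by apply: (iffP (asboolP _)). Qed.

Lemma psi_unit s : psi s != 0 -> phi s != 0.
Proof. by apply: contraNneq => /ker_phi ->. Qed.

Lemma local_ring_phi s : phi s \in local_ring.
Proof. by apply/local_ringP; exists s, 1; rewrite !rmorph1 oner_eq0 divr1. Qed.

Lemma local_ring_subring : GRing.subring_closed local_ring.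
Proof.
split; first by rewrite -(rmorph1 phi) local_ring_phi.
- move=> _ _ /local_ringP[g [h [h0 ->]]] /local_ringP[g' [h' [h'0 ->]]].
  apply/local_ringP; exists (g * h' - g' * h), (h * h').
  rewrite !rmorphB !rmorphM mulf_neq0 //; split=> //.
  by field; rewrite !psi_unit.
- move=> _ _ /local_ringP[g [h [h0 ->]]] /local_ringP[g' [h' [h'0 ->]]].
  apply/local_ringP; exists (g * g'), (h * h').
  rewrite !rmorphM mulf_neq0 //; split=> //.
  by field; rewrite !psi_unit.
Qed.

Lemma local_ringM f f' :
  f \in local_ring -> f' \in local_ring -> f * f' \in local_ring.
Proof. by have [_ _ OM] := local_ring_subring; apply: OM. Qed.

Variable pi : S.
Hypotheses (psi_pi : psi pi = 0) (phi_pi : phi pi != 0).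

(** The nonzero elements are units times powers of one element [pi] that vanishes
    at the point: the local ring is then a discrete valuation ring. *)
Definition uniformized f := exists z g h,
  [/\ psi g != 0, psi h != 0 & f = phi g / phi h * phi pi ^ z].

Lemma uniformizedM f f' :
  uniformized f -> uniformized f' -> uniformized (f * f').
Proof.
move=> [z [g [h [g0 h0 ->]]]] [z' [g' [h' [g'0 h'0 ->]]]].
exists (z + z'), (g * g'), (h * h'); rewrite !rmorphM !mulf_neq0 //; split=> //.
rewrite expfzDr //; field; rewrite !psi_unit //.
Qed.

Lemma uniformizedV f : uniformized f -> uniformized f^-1.
Proof.
move=> [z [g [h [g0 h0 ->]]]]; exists (- z), h, g; split=> //.
by rewrite invfM invf_div invr_expz.
Qed.

Lemma uniformized_unit s : psi s != 0 -> uniformized (phi s).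
Proof.
by move=> s0; exists 0, s, 1; rewrite !rmorph1 oner_eq0 divr1 expr0z mulr1.
Qed.

Lemma uniformized_pi : uniformized (phi pi).
Proof. by exists 1, 1, 1; rewrite !rmorph1 oner_eq0 divr1 expr1z mul1r. Qed.

Lemma uniformizedX f n : uniformized f -> uniformized (f ^+ n).
Proof.
move=> Uf; elim: n => [|n IHn]; last by rewrite exprS; apply: uniformizedM.
by rewrite expr0 -(rmorph1 phi); apply: uniformized_unit; rewrite rmorph1 oner_eq0.
Qed.

Lemma uniformized_local_ring f :
  uniformized f -> f \in local_ring \/ f^-1 \in local_ring.
Proof.
have loc (n : nat) g h : psi g != 0 -> psi h != 0 ->
    phi g / phi h * phi pi ^+ n \in local_ring.
  move=> g0 h0; rewrite -rmorphXn /=; apply: local_ringM; last exact: local_ring_phi.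
  by apply/local_ringP; exists g, h.
move=> [[n|n] [g [h [g0 h0 ->]]]]; first by left; apply: loc.
right; rewrite NegzE invfM invf_div invr_expz opprK; exact: loc.
Qed.

Hypothesis phi_const : forall c, exists s, phi s = iota c.
Hypothesis all_uniformized : forall f, f != 0 -> uniformized f.

(** The inverse of [pi] is the element outside the ring: if it were [g / h] with
    [h] not zero at the point, then [h = g pi] would vanish there. *)
Lemma local_ring_valuation : valuation_ring iota local_ring.
Proof.
split.
- exact: local_ring_subring.
- by move=> c; have [s <-] := phi_const c; apply: local_ring_phi.
- exists (phi pi)^-1; apply/local_ringP => -[g [h [h0 E]]].
  have : phi (h - g * pi) = 0.
    rewrite rmorphB rmorphM; have := psi_unit h0 => h1.
    have -> : phi g = (phi pi)^-1 * phi h by rewrite E divfK.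
    by field.
  by move/ker_phi/eqP; rewrite rmorphB rmorphM psi_pi mulr0 subr0 (negPf h0).
- move=> f; have [->|f0] := eqVneq f 0.
    by left; rewrite -(rmorph0 phi) local_ring_phi.
  exact/uniformized_local_ring/all_uniformized.
Qed.

Variable om : derivation iota -> F.
Hypothesis der_phi :
  forall s, exists s', forall D : derivation iota, D (phi s) = phi s' * om D.

Lemma der_local_ring f : f \in local_ring ->
  exists2 f', f' \in local_ring & forall D : derivation iota, D f = f' * om D.
Proof.
move=> /local_ringP[g [h [h0 ->]]].
have [[g' Dg] [h' Dh]] := (der_phi g, der_phi h).
exists (phi (h * g' - g * h') / phi (h ^+ 2)).
  apply/local_ringP; exists (h * g' - g * h'), (h ^+ 2); split=> //.
  by rewrite rmorphXn expf_neq0.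
move=> D; rewrite der_div ?psi_unit // Dg Dh rmorphB !rmorphM /=.
by field; rewrite psi_unit.
Qed.

Lemma regular_local_ring u : regular_differential u ->
  exists2 f, f \in local_ring & forall D, u D = f * om D.
Proof.
case=> _ /(_ _ local_ring_valuation).
exact: (differential_over_ring local_ring_subring der_local_ring).
Qed.

End LocalRing.

Section RationalPart.
Variables (k F : fieldType) (iota : {rmorphism k -> F}) (S : comNzRingType).
Variables (phi : {rmorphism S -> F}) (psi : {rmorphism S -> k}).
Hypothesis ker_phi : forall s, phi s = 0 -> psi s = 0.
Variables (pi : S) (x : F) (a : k).
Hypothesis phi_pi : phi pi != 0.
Hypothesis U_Xa : uniformized phi psi pi (x - iota a).
Hypothesis U_unit : forall q, q.[a] != 0 -> uniformized phi psi pi (peval iota x q).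

(** Over a point [x = a], only the factor [x - a] of a polynomial in [x] can fail
    to be a unit, so that the elements of [k(x)] are covered as soon as [x - a]
    is. *)
Lemma uniformized_peval p : p != 0 -> uniformized phi psi pi (peval iota x p).
Proof.
move=> p0; have [n [q /implyP/(_ p0) qa ->]] := multiplicity_XsubC p a.
rewrite rmorphM rmorphXn rmorphB /= pevalX pevalC.
by apply: uniformizedM => //; [apply: U_unit | apply: uniformizedX].
Qed.

Lemma uniformized_rational f :
  f != 0 -> rational_in iota x f -> uniformized phi psi pi f.
Proof.
move=> f0 [p [q [q0 E]]]; rewrite E in f0 *.
have p0 : p != 0 by apply: contraNneq f0 => ->; rewrite rmorph0 mul0r.
have qN0 : q != 0 by apply: contraNneq q0 => ->; rewrite rmorph0.
by apply: uniformizedM => //; [|apply: uniformizedV]; apply: uniformized_peval.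
Qed.
End RationalPart.

(** * Fields of rational functions in one variable *)

Section RationalField.
Variables (k : closedFieldType) (F : fieldType) (iota : {rmorphism k -> F}).
Implicit Types (D : derivation iota).

Section Generator.
Variable m : F.
Hypotheses (tm : transcendental iota m) (genm : forall f, rational_in iota m f).

(** Regularity of [f dm] at the point [m = c] says that [c] is not a root of the
    denominator of [f]; a denominator without roots is constant. *)
Lemma rational_regular_poly u D0 : regular_differential u -> D0 m != 0 ->
  exists p, forall D, u D = peval iota m p * D m.
Proof.
move=> ru Dm0.
pose O c := local_ring (peval iota m) (horner_eval c).
have ker c s : peval iota m s = 0 -> horner_eval c s = 0.
  by move/tm->; rewrite rmorph0.
have piN0 c : peval iota m ('X - c%:P) != 0.
  by rewrite transcendental_neq0 // polyXsubC_eq0.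
have pi0 (c : k) : horner_eval c ('X - c%:P) = 0 by rewrite /horner_eval hornerXsubC subrr.
have cst c : exists s, peval iota m s = iota c by exists c%:P; rewrite pevalC.
have unif c f : f != 0 -> uniformized (peval iota m) (horner_eval c) ('X - c%:P) f.
  move=> f0; apply: (uniformized_rational (ker c) (piN0 c) (x := m) (a := c)) => //.
    have := uniformized_pi (peval iota m) (horner_eval c) ('X - c%:P).
    by rewrite rmorphB /= pevalX pevalC.
  by move=> q qc; apply: uniformized_unit.
have der s : exists s', forall D, D (peval iota m s) = peval iota m s' * D m.
  by exists s^`() => D; apply: der_peval.
have reg c := regular_local_ring (ker c) (pi0 c) (piN0 c) cst (unif c) der ru.
have [f _ uf] := reg 0.
have fO c : f \in O c.
  by have [f' f'O uf'] := reg c; rewrite (mulIf Dm0 (etrans (esym (uf D0)) (uf' D0))).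
have [p [q [q0 cpq Ef]]] := rational_in_reduce tm (genm f).
have sq : size q == 1%N.
  apply/negPn/negP=> /closed_rootP[c qc].
  have pc : p.[c] != 0 by apply: coprimep_root qc; rewrite coprimep_sym.
  have /local_ringP[g [h [hc E]]] := fO c.
  have : p * h = g * q.
    apply: (transcendental_inj tm); rewrite !rmorphM; apply/eqP.
    have hx : peval iota m h != 0 := psi_unit (ker c) hc.
    have qx := transcendental_neq0 tm q0.
    by rewrite -eqr_div //; apply/eqP; rewrite -Ef -E.
  move/(congr1 (horner_eval c)); rewrite !rmorphM [X in _ = _ * X](rootP qc) mulr0.
  by move/eqP; rewrite mulf_eq0 (negPf hc) orbF; apply/negP.
have /size_poly1P[e e0 Eq] := sq.
exists (e^-1 *: p) => D; rewrite uf Ef Eq pevalC pevalZ fmorphV.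
by ring.
Qed.

End Generator.

Lemma rational_field_genus0 m : transcendental iota m ->
  (forall f, rational_in iota m f) -> field_genus iota 0.
Proof.
move=> tm genm; exists (fun _ _ => 0); split; first by case.
  by move=> c _ [].
move=> u ru; exists (fun _ => 0) => D; rewrite big_ord0.
have m0 := transcendental_self_neq0 tm.
have [Dm0|Dm0] := eqVneq (D m) 0.
  have D0 f : D f = 0.
    have [p [q [q0 ->]]] := genm f.
    by rewrite der_div // !der_peval Dm0 !mulr0 subrr mul0r.
  by case: ru => -[s [_ ->]] _; apply: big1 => ab _; rewrite D0 mulr0.
have [p up] := rational_regular_poly tm genm ru Dm0.
(* the point at infinity is the origin of the chart 1 / m *)
have [|f||q uq] := @rational_regular_poly m^-1 _ _ u D ru.
- exact: transcendentalV.
- exact/rational_inVE.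
- by rewrite derV // mulf_neq0 ?oppr_eq0 ?invr_eq0 ?expf_neq0.
have /(peval_eqV tm)[_ /(_ isT) p0] : peval iota m p * m ^+ 2 = peval iota m^-1 (- q).
  apply: (mulIf Dm0); have := uq D; rewrite up derV // => E.
  rewrite rmorphN /=; transitivity (m ^+ 2 * (peval iota m p * D m)); first by ring.
  by rewrite E; field.
by rewrite up p0 rmorph0 mul0r.
Qed.

End RationalField.

(** * Curves of bidegree (2, 2) with a double point *)

Section Conic.
Variables (k : closedFieldType) (F : fieldType) (iota : {rmorphism k -> F}).

(** An algebraic element over an algebraically closed field is in that field. *)
Lemma transcendental_notin m : (forall c, m <> iota c) -> transcendental iota m.
Proof.
move=> mN p pm; apply/eqP/negbNE/negP=> p0.
have [r Er] := closed_field_poly_normal p.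
move: pm; rewrite Er pevalZ rmorph_prod /= => /eqP.
rewrite mulf_eq0 fmorph_eq0 lead_coef_eq0 (negPf p0) /=.
rewrite prodf_seq_eq0 => /hasP[c _] /=.
by rewrite rmorphB /= pevalX pevalC subr_eq0 => /eqP/mN.
Qed.

Variables (x y : F) (A B C D E G : k).
Hypotheses (ty : transcendental iota y) (xNy : ~ rational_in iota y x).
Hypothesis gen : generated_by iota x y.
Hypotheses (A0 : A != 0) (C0 : C != 0).
Hypothesis rel : x * y =
  iota A * x ^+ 2 + iota B * (x * y) + iota C * y ^+ 2 +
  iota D * (x ^+ 2 * y) + iota E * (x * y ^+ 2) + iota G * (x ^+ 2 * y ^+ 2).

(** Dividing the equation by [x^2], the coordinates [s = y / x] and [y] satisfy an
    equation of degree two.  The conic meets the line [y = 0] at a point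
    [s = s0], and the slope [m = (s - s0) / y] determines the other intersection
    of the conic with a line through that point: [y] is a quotient of polynomials
    in [m].  If [m] were a constant, the conic would contain a line, and
    [x] would be a rational function of [y]. *)
Lemma double_point_genus0 : field_genus iota 0.
Proof.
have x0 : x != 0.
  apply: contra_not_neq xNy => ->; rewrite -(rmorph0 (peval iota y)).
  exact: rational_in_peval.
have y0 := transcendental_self_neq0 ty.
pose s := y / x.
have conic : iota C * s ^+ 2 + (iota B - 1) * s + iota A + iota D * y +
    iota E * (s * y) + iota G * y ^+ 2 = 0.
  have -> : 0 = (iota A * x ^+ 2 + iota B * (x * y) + iota C * y ^+ 2 +
    iota D * (x ^+ 2 * y) + iota E * (x * y ^+ 2) + iota G * (x ^+ 2 * y ^+ 2)
    - x * y) / x ^+ 2 by rewrite -rel subrr mul0r.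
  by rewrite /s; field.
have [s0 rs0] : exists s0, root (Poly [:: A; B - 1; C]) s0.
  apply/closed_rootP; rewrite (@PolyK _ 0) //= .
have {rs0} Es0 : C * s0 ^+ 2 + (B - 1) * s0 + A = 0.
  by move/rootP: rs0; rewrite horner_Poly /= => <-; ring.
pose m := (s - iota s0) / y.
have Es : s = iota s0 + m * y by rewrite /m; field.
pose pA := (2 * C * s0 + (B - 1)) *: 'X + (D + E * s0)%:P.
pose pB := C *: 'X^2 + E *: 'X + G%:P.
have line : peval iota m pA + peval iota m pB * y = 0.
  have Es0F : iota C * iota s0 ^+ 2 + (iota B - 1) * iota s0 + iota A = 0.
    rewrite -(rmorph0 iota) -Es0.
    by rewrite !(rmorphB, rmorphXn, rmorphD, rmorphM, rmorph_nat, rmorph1, rmorph0).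
  apply: (mulIf y0); rewrite mul0r -[RHS]conic Es /pA /pB.
  rewrite !rmorphD /= !pevalZ !pevalC rmorphXn /= !pevalX.
  rewrite !(rmorphB, rmorphXn, rmorphD, rmorphM, rmorph_nat, rmorph1, rmorph0).
  have -> : iota A = - (iota C * iota s0 ^+ 2 + (iota B - 1) * iota s0).
    by apply/eqP; rewrite -addr_eq0 addrC Es0F.
  by ring.
have sN0 : s0 != 0.
  by apply: contraNneq A0 => s00; move: Es0; rewrite s00 expr0n !mulr0 !add0r => ->.
have tm : transcendental iota m.
  apply: transcendental_notin => c Em; apply: xNy.
  have d0 : peval iota y (s0%:P + c *: 'X) != 0.
    apply: transcendental_neq0 => //; apply: contraNneq sN0 => /polyP/(_ 0%N).
    by rewrite coefD coefC coefZ coefX mulr0 addr0 coef0 => ->.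
  exists 'X, (s0%:P + c *: 'X); split=> //.
  rewrite rmorphD /= pevalZ pevalC pevalX -Em -Es /s in d0 *.
  by field; rewrite x0.
apply: (rational_field_genus0 tm) => f.
have sub := rational_in_subfield iota m; have [PC PD PM PV] := sub.
have my : rational_in iota m y.
  have pB0 : pB != 0.
    apply: contraNneq C0 => /polyP/(_ 2%N).
    by rewrite !coefD !coefZ coefXn coefX coefC coef0 mulr1 mulr0 !addr0 => ->.
  exists (- pA), pB; split; first exact: transcendental_neq0.
  rewrite rmorphN; apply: (mulIf (transcendental_neq0 tm pB0)).
  rewrite divfK ?transcendental_neq0 //; apply/eqP; rewrite -addr_eq0.
  by rewrite mulrC addrC line.
have mm := rational_in_self iota m.
have ms : rational_in iota m s by rewrite Es; apply: PD => //; apply: PM.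
apply: gen => //; have -> : x = y * s^-1 by rewrite /s; field; rewrite x0 y0.
by apply: PM => //; apply: PV.
Qed.

End Conic.

(** * Points of a double cover of the line *)

Section DoubleCover.
Variables (k : numClosedFieldType) (F : fieldType) (iota : {rmorphism k -> F}).

(** The affine curve [eta^2 = Delta(x)] with its function field [F]; it is smooth
    since [Delta] is separable, and irreducible since [eta] is not in [k(x)]. *)
Definition double_cover x eta Delta := [/\ transcendental iota x,
  eta ^+ 2 = peval iota x Delta, ~ rational_in iota x eta,
  generated_by iota x eta & separable_poly Delta].

Section Affine.
Variables (x eta : F) (Delta : {poly k}).
Hypothesis cover : double_cover x eta Delta.
Local Notation ev := (peval iota x).

Let tx : transcendental iota x. Proof. by case: cover. Qed.
Let eta2 : eta ^+ 2 = ev Delta. Proof. by case: cover. Qed.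
Let etaN : ~ rational_in iota x eta. Proof. by case: cover. Qed.
Let ev_neq0 p : p != 0 -> ev p != 0. Proof. exact: transcendental_neq0. Qed.

Lemma eta_neq0 : eta != 0.
Proof.
apply: contra_not_neq etaN => ->; rewrite -(rmorph0 (peval iota x)).
exact: rational_in_peval.
Qed.

Lemma two_neq0 : 2 != 0 :> F.
Proof. by rewrite -(rmorph_nat iota 2) fmorph_eq0 pnatr_eq0. Qed.

Lemma cover_free_poly a b : ev a + ev b * eta = 0 -> a = 0 /\ b = 0.
Proof.
by case/(rational_free etaN); [exact: rational_in_peval..|move=> /tx-> /tx->].
Qed.

(** These quotients form a subfield; inverses are obtained by multiplying by the
    conjugate [a - b eta]. *)
Lemma cover_repr f :
  exists a b c, c != 0 /\ f = (ev a + ev b * eta) / ev c.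
Proof.
have [_ _ _ gen _] := cover; move: f; apply: gen; first split.
- by move=> c; exists c%:P, 0, 1; rewrite oner_neq0 pevalC !rmorph0 rmorph1 mul0r addr0 divr1.
- move=> _ _ [a [b [c [c0 ->]]]] [a' [b' [c' [c'0 ->]]]].
  exists (a * c' + a' * c), (b * c' + b' * c), (c * c').
  rewrite mulf_neq0 // !rmorphD !rmorphM; split=> //.
  by field; rewrite !ev_neq0.
- move=> _ _ [a [b [c [c0 ->]]]] [a' [b' [c' [c'0 ->]]]].
  exists (a * a' + b * b' * Delta), (a * b' + b * a'), (c * c').
  rewrite mulf_neq0 // !rmorphD !rmorphM /= -eta2; split=> //.
  by field; rewrite !ev_neq0.
- move=> _ [a [b [c [c0 ->]]]]; rewrite invf_div.
  have [t0|t0] := eqVneq (ev a + ev b * eta) 0.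
    exists 0, 0, 1; rewrite oner_neq0 t0 invr0 !rmorph0; split=> //; ring.
  have t'0 : ev a - ev b * eta != 0.
    apply: contraNneq t0; rewrite -mulNr -rmorphN => /cover_free_poly[-> /eqP].
    by rewrite oppr_eq0 => /eqP ->; rewrite !rmorph0 mul0r addr0.
  have N0 : ev (a ^+ 2 - b ^+ 2 * Delta) != 0.
    rewrite !(rmorphB, rmorphXn, rmorphM) /= -eta2.
    have -> : ev a ^+ 2 - ev b ^+ 2 * eta ^+ 2 =
      (ev a + ev b * eta) * (ev a - ev b * eta) by ring.
    by rewrite mulf_neq0.
  exists (c * a), (- (c * b)), (a ^+ 2 - b ^+ 2 * Delta); split.
    by apply: contraNneq N0 => ->; rewrite rmorph0.
  rewrite !(rmorphN, rmorphB, rmorphXn, rmorphM) /= -eta2.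
  have -> : ev a ^+ 2 - ev b ^+ 2 * eta ^+ 2 =
    (ev a + ev b * eta) * (ev a - ev b * eta) by ring.
  by field; apply/andP.
- by exists 'X, 0, 1; rewrite oner_neq0 pevalX !rmorph0 rmorph1 mul0r addr0 divr1.
- by exists 0, 1, 1; rewrite oner_neq0 !rmorph0 !rmorph1 mul1r add0r divr1.
Qed.

Definition curve_eval : {poly {poly k}} -> F := horner_eval eta \o map_poly (peval iota x).
HB.instance Definition _ :=
  GRing.RMorphism.copy curve_eval (horner_eval eta \o map_poly (peval iota x)).

Definition place_eval (al ep : k) : {poly {poly k}} -> k :=
  horner_eval ep \o map_poly (horner_eval al).
HB.instance Definition _ al ep :=
  GRing.RMorphism.copy (place_eval al ep) (horner_eval ep \o map_poly (horner_eval al)).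

Definition place_ring al ep : {pred F} := local_ring curve_eval (place_eval al ep).

Lemma curve_evalC p : curve_eval p%:P = peval iota x p.
Proof. by rewrite /curve_eval /= map_polyC /horner_eval hornerC. Qed.

Lemma curve_evalX : curve_eval 'X = eta.
Proof. by rewrite /curve_eval /= map_polyX /horner_eval hornerX. Qed.

Lemma place_evalC al ep p : place_eval al ep p%:P = p.[al].
Proof. by rewrite /place_eval /= map_polyC /horner_eval hornerC. Qed.

Lemma place_evalX al ep : place_eval al ep 'X = ep.
Proof. by rewrite /place_eval /= map_polyX /horner_eval hornerX. Qed.

(** Reduction modulo [eta^2 - Delta] commutes with evaluation at the points of the
    curve. *)
Lemma cover_normal_form s : exists a b, curve_eval s = ev a + ev b * eta /\
  forall al ep, ep ^+ 2 = Delta.[al] -> place_eval al ep s = a.[al] + b.[al] * ep.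
Proof.
elim/poly_ind: s => [|s c [a [b [Es Ps]]]].
  by exists 0, 0; split=> [|al ep _]; rewrite !rmorph0 ?horner0 mul0r addr0.
exists (b * Delta + c), a; split=> [|al ep Eep].
  rewrite rmorphD rmorphM /= curve_evalX curve_evalC Es rmorphD rmorphM /= -eta2; ring.
rewrite rmorphD rmorphM /= place_evalX place_evalC Ps // hornerD hornerM -Eep; ring.
Qed.

Section Place.
Variables (al ep : k).
Hypothesis Eep : ep ^+ 2 = Delta.[al].

Lemma cover_ker s : curve_eval s = 0 -> place_eval al ep s = 0.
Proof.
have [a [b [-> Ps]]] := cover_normal_form s.
by move/cover_free_poly=> [a0 b0]; rewrite Ps // a0 b0 !horner0 mul0r addr0.
Qed.

(** Away from the branch points, [x - al] is a local parameter; at a branch point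
    [x - al] vanishes twice and [eta] is one. *)
Definition place_uniformizer : {poly {poly k}} :=
  if ep == 0 then 'X else ('X - al%:P)%:P.

Lemma place_eval_uniformizer : place_eval al ep place_uniformizer = 0.
Proof.
rewrite /place_uniformizer; have [->|e0] := eqVneq; first by rewrite place_evalX.
by rewrite place_evalC hornerXsubC subrr.
Qed.

Lemma curve_eval_uniformizer : curve_eval place_uniformizer != 0.
Proof.
rewrite /place_uniformizer; case: ifP => _; first by rewrite curve_evalX eta_neq0.
by rewrite curve_evalC ev_neq0 // polyXsubC_eq0.
Qed.

Let U := uniformized curve_eval (place_eval al ep) place_uniformizer.

Lemma cover_unit p : p.[al] != 0 -> U (ev p).
Proof.
rewrite -(place_evalC al ep) -curve_evalC => pa.
exact: (@uniformized_unit _ _ _ curve_eval (place_eval al ep)).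
Qed.

Let M f g : U f -> U g -> U (f * g).
Proof. exact: (uniformizedM cover_ker curve_eval_uniformizer). Qed.

(** A double root of [Delta] would be a singular point. *)
Lemma branch_factor : ep = 0 ->
  exists2 Delta1, Delta = Delta1 * ('X - al%:P) & Delta1.[al] != 0.
Proof.
move=> e0; have rD : root Delta al by rewrite rootE -Eep e0 expr0n.
have /factor_theorem[D1 ED] := rD; exists D1 => //; apply/negP => rD1.
have [_ _ _ _] := cover; rewrite unlock => sep; have := coprimep_root sep rD.
by rewrite ED derivM derivXsubC !hornerE subrr (eqP rD1) mulr0 addr0 eqxx.
Qed.

Lemma uniformized_XsubC : U (x - iota al).
Proof.
have -> : x - iota al = ev ('X - al%:P) by rewrite rmorphB /= pevalX pevalC.
have [e0|e0] := eqVneq ep 0; last first.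
  have <- : curve_eval place_uniformizer = ev ('X - al%:P).
    by rewrite /place_uniformizer (negPf e0) curve_evalC.
  exact: uniformized_pi.
have [D1 ED D1al] := branch_factor e0.
have D10 : D1 != 0 by apply: contraNneq D1al => ->; rewrite horner0.
have -> : ev ('X - al%:P) = eta * eta * (ev D1)^-1.
  by rewrite -expr2 eta2 ED rmorphM /=; field; exact: ev_neq0.
have Ue : U eta.
  have <- : curve_eval place_uniformizer = eta.
    by rewrite /place_uniformizer e0 eqxx curve_evalX.
  exact: uniformized_pi.
by apply: M; [apply: M | apply/uniformizedV/cover_unit].
Qed.

(** Write [f] as an element of [k(x)] times [a + b eta] with [a] and [b] coprime.
    If [a + b eta] vanishes at the point and the point is not a branch point, the
    conjugate [a - b eta] does not vanish, because [a] and [b] have no common zero;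
    so [a + b eta] is a unit times the norm [a^2 - b^2 Delta], which is in
    [k(x)].  At a branch point [a] vanishes and [b] does not, and dividing by
    [eta] leaves a unit. *)
Lemma cover_uniformized f : f != 0 -> U f.
Proof.
have Ux f' := uniformized_rational cover_ker curve_eval_uniformizer
  uniformized_XsubC cover_unit (f := f').
have Up p : p != 0 -> U (ev p).
  by move=> p0; apply: Ux; [exact: ev_neq0 | exact: rational_in_peval].
have [a [b [c [c0 ->]]]] := cover_repr f => f0.
apply: M; last exact/uniformizedV/Up.
have g0 : gcdp a b != 0.
  apply: contraNneq f0 => /eqP; rewrite gcdp_eq0 => /andP[/eqP-> /eqP->].
  by rewrite !rmorph0 mul0r addr0 mul0r.
have cop : coprimep (a %/ gcdp a b) (b %/ gcdp a b).
  by apply: coprimep_div_gcd; rewrite -negb_and -gcdp_eq0.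
have Ea := esym (divpK (dvdp_gcdl a b)); have Eb := esym (divpK (dvdp_gcdr a b)).
move: (gcdp a b) (a %/ _) (b %/ _) g0 cop Ea Eb f0 => d a1 b1 d0 cop -> -> f0.
have Et : ev (a1 * d) + ev (b1 * d) * eta = ev d * (ev a1 + ev b1 * eta).
  by rewrite !rmorphM /=; ring.
rewrite Et in f0 *; apply: M; first exact: Up.
have t0 : ev a1 + ev b1 * eta != 0.
  by apply: contraNneq f0 => ->; rewrite mulr0 mul0r.
pose t := a1%:P + b1%:P * 'X; pose t' := a1%:P - b1%:P * 'X.
have evalt : curve_eval t = ev a1 + ev b1 * eta.
  by rewrite rmorphD rmorphM /= !curve_evalC curve_evalX.
have evalt' : curve_eval t' = ev a1 - ev b1 * eta.
  by rewrite rmorphB rmorphM /= !curve_evalC curve_evalX.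
have pevt : place_eval al ep t = a1.[al] + b1.[al] * ep.
  by rewrite rmorphD rmorphM /= !place_evalC place_evalX.
have pevt' : place_eval al ep t' = a1.[al] - b1.[al] * ep.
  by rewrite rmorphB rmorphM /= !place_evalC place_evalX.
have ab_al : ~ (a1.[al] = 0 /\ b1.[al] = 0).
  by case=> a0 b0; have := coprimep_root cop (introT eqP a0); rewrite b0 eqxx.
have [pt0|pt0] := eqVneq (place_eval al ep t) 0; last first.
  by rewrite -evalt; apply: uniformized_unit.
have [e0|e0] := eqVneq ep 0.
  have [D1 ED D1al] := branch_factor e0.
  have D10 : D1 != 0 by apply: contraNneq D1al => ->; rewrite horner0.
  have a1al : a1.[al] = 0 by move: pt0; rewrite pevt e0 mulr0 addr0.
  have /factor_theorem[a2 Ea2] : root a1 al by apply/eqP.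
  have Efac : ev a1 + ev b1 * eta =
      curve_eval place_uniformizer * curve_eval (b1%:P * D1%:P + a2%:P * 'X) * (ev D1)^-1.
    rewrite /place_uniformizer e0 eqxx rmorphD !rmorphM /= !curve_evalC !curve_evalX.
    apply: (mulIf (ev_neq0 D10)); rewrite divfK ?ev_neq0 //.
    have E : ev D1 * ev ('X - al%:P) = eta ^+ 2 by rewrite eta2 ED rmorphM.
    rewrite Ea2 !rmorphM /=.
    transitivity (ev a2 * (ev D1 * ev ('X - al%:P)) + ev b1 * eta * ev D1); first by ring.
    by rewrite E; ring.
  rewrite Efac; apply: M; last exact/uniformizedV/Up.
  apply: M; first exact: uniformized_pi.
  apply: uniformized_unit; rewrite rmorphD !rmorphM /= !place_evalC place_evalX e0 mulr0 addr0.
  rewrite mulf_neq0 //; apply/eqP => b0; exact: ab_al.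
have pt'0 : place_eval al ep t' != 0.
  apply/eqP => pt'0; apply: ab_al.
  move: pt0 pt'0; rewrite pevt pevt' => E1 E2.
  have a0 : a1.[al] = 0.
    apply: (mulfI (x := 2)); first by rewrite pnatr_eq0.
    by rewrite mulr0 -[RHS]addr0 -{1}E1 -E2; ring.
  split=> //; apply: (mulIf e0); rewrite mul0r -E1 a0 add0r //.
have t'0 : ev a1 - ev b1 * eta != 0.
  by rewrite -evalt'; apply: (psi_unit cover_ker pt'0).
have EN : (ev a1 + ev b1 * eta) * (ev a1 - ev b1 * eta) =
    ev (a1 ^+ 2 - b1 ^+ 2 * Delta).
  by rewrite !(rmorphB, rmorphXn, rmorphM) /= -eta2; ring.
have -> : ev a1 + ev b1 * eta =
    ev (a1 ^+ 2 - b1 ^+ 2 * Delta) * (curve_eval t')^-1.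
  by rewrite -EN evalt' mulfK.
apply: M; last by apply/uniformizedV/uniformized_unit.
apply: Up; apply/eqP => N0; move: EN; rewrite N0 rmorph0.
by apply/eqP; rewrite mulf_neq0.
Qed.

End Place.
End Affine.
End DoubleCover.

(** * Regular differentials on a double cover *)

Section DoubleCoverDifferentials.
Variables (k : numClosedFieldType) (F : fieldType) (iota : {rmorphism k -> F}).
Implicit Type D : derivation iota.

(** The differential [dx / eta], which has neither zeros nor poles on a smooth
    curve [eta^2 = Delta(x)]. *)
Definition invariant_form (x eta : F) : derivation iota -> F := fun D => D x / eta.

Section Affine.
Variables (x eta : F) (Delta : {poly k}).
Hypothesis cover : double_cover iota x eta Delta.
Local Notation ev := (peval iota x).
Local Notation curve_eval := (curve_eval iota x eta).

Let tx : transcendental iota x. Proof. by case: cover. Qed.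
Let eta2 : eta ^+ 2 = ev Delta. Proof. by case: cover. Qed.
Let etaN0 : eta != 0. Proof. exact: eta_neq0 cover. Qed.
Let two0 : 2 != 0 :> F. Proof. exact: two_neq0 iota. Qed.

(** Differentiate [eta^2 = Delta(x)]. *)
Lemma der_eta D : D eta = 2^-1 * ev Delta^`() * invariant_form x eta D.
Proof.
have := congr1 (der_fun D) eta2; rewrite expr2 derM der_peval => E.
have {}E : D eta * (2 * eta) = ev Delta^`() * D x by rewrite -E; ring.
apply: (mulIf (mulf_neq0 two0 etaN0)); rewrite E /invariant_form.
by field; rewrite etaN0 two0.
Qed.

Lemma der_curve_eval s : exists s', forall D,
  D (curve_eval s) = curve_eval s' * invariant_form x eta D.
Proof.
elim/poly_ind: s => [|s c [s' Es]].
  by exists 0 => D; rewrite !rmorph0 der0 mul0r.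
exists (s' * 'X + s * (2^-1 *: Delta^`())%:P + c^`()%:P * 'X) => D.
rewrite !(rmorphD, rmorphM) /= !curve_evalX !curve_evalC derD derM der_peval Es der_eta pevalZ.
rewrite fmorphV rmorph_nat /invariant_form.
by field; rewrite two0 etaN0.
Qed.

Lemma cover_regular_local (al ep : k) u : ep ^+ 2 = Delta.[al] ->
  regular_differential u -> exists2 f, f \in place_ring iota x eta al ep &
    forall D, u D = f * invariant_form x eta D.
Proof.
move=> Eep ru.
apply: (regular_local_ring (cover_ker cover Eep) (place_eval_uniformizer al ep)
   (curve_eval_uniformizer cover al ep) _ (cover_uniformized cover Eep) der_curve_eval ru).
by move=> c; exists c%:P%:P; rewrite /= curve_evalC pevalC.
Qed.

(** Let [f = (a + b eta) / c].  At a root [al] of [c], regularity at both points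
    over [al] makes [a + b ep] vanish for both square roots [ep] of [Delta(al)], so
    that [a] and [b] vanish at [al] unless it is a branch point.  At a branch point
    the coefficient of [eta] in the equation gives the vanishing of [b].  Hence
    [x - al] divides the numerator, and can be removed. *)
Lemma everywhere_local_poly f :
  (forall al ep, ep ^+ 2 = Delta.[al] -> f \in place_ring iota x eta al ep) ->
  exists a b, f = ev a + ev b * eta.
Proof.
move=> fO; have [a [b [c [c0 Ef]]]] := cover_repr cover f.
elim: {c}(size c).+1 {-2}c (ltnSn (size c)) a b c0 Ef => // n IHn c sc a b c0 Ef.
have evc0 := transcendental_neq0 tx c0.
have [/size_poly1P[e e0 Ec]|/closed_rootP[al rc]] := boolP (size c == 1%N).
  exists (e^-1 *: a), (e^-1 *: b); rewrite Ef Ec !pevalZ pevalC fmorphV.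
  by field; rewrite fmorph_eq0.
have root_ab ep : ep ^+ 2 = Delta.[al] -> a.[al] + b.[al] * ep = 0 /\
    (ep = 0 -> b.[al] = 0).
  move=> Eep; have /local_ringP[g [h [h0 E]]] := fO _ _ Eep.
  have hx0 := psi_unit (cover_ker cover Eep) h0.
  have [g0 [g1 [Eg Pg]]] := cover_normal_form cover g.
  have [h1 [h2 [Eh Ph]]] := cover_normal_form cover h.
  rewrite /= Ph // in h0; rewrite /= Eh in hx0.
  have cross : (ev a + ev b * eta) * (ev h1 + ev h2 * eta) =
      (ev g0 + ev g1 * eta) * ev c.
    by apply/eqP; rewrite -eqr_div //; apply/eqP; rewrite -Ef E /= Eg Eh.
  (* compare the coefficients of 1 and of eta *)
  have {cross}[E1 E2] : a * h1 + b * h2 * Delta - g0 * c = 0 /\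
      a * h2 + b * h1 - g1 * c = 0.
    apply: (cover_free_poly cover).
    rewrite !(rmorphB, rmorphD, rmorphM) /= -eta2.
    move/eqP: cross; rewrite -subr_eq0 => /eqP <-; ring.
  have := congr1 (horner_eval al) E1; have := congr1 (horner_eval al) E2.
  rewrite !(rmorphB, rmorphD, rmorphM) !rmorph0 /= /horner_eval (rootP rc) -Eep.
  rewrite !mulr0 !subr0 => {}E2 {}E1; split=> [|e0].
    by apply: (mulIf h0); rewrite mul0r -[RHS]addr0 -{1}E1 -(mul0r ep) -E2; ring.
  move: E1 E2 h0; rewrite e0 !mulr0 !addr0 expr0n mulr0 addr0.
  move/eqP; rewrite mulf_eq0 => /orP[/eqP->|/eqP->]; last by rewrite eqxx.
  by rewrite mul0r add0r => /eqP; rewrite mulf_eq0 => /orP[/eqP|/eqP->] //; rewrite eqxx.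
pose ep := sqrtC Delta.[al]; have Eep : ep ^+ 2 = Delta.[al] by rewrite sqrtCK.
have [R1 R2] := root_ab _ Eep.
have [|R3 _] := root_ab (- ep); first by rewrite sqrrN.
have a0 : a.[al] = 0.
  apply: (mulfI (x := 2)); first by rewrite pnatr_eq0.
  by rewrite mulr0 -[RHS]addr0 -{1}R1 -R3; ring.
have b0 : b.[al] = 0.
  have [|e0] := eqVneq ep 0; first exact: R2.
  by apply: (mulIf e0); rewrite mul0r -R1 a0 add0r.
have /factor_theorem[a' Ea] : root a al by apply/eqP.
have /factor_theorem[b' Eb] : root b al by apply/eqP.
have /factor_theorem[c' Ec] := rc.
have c'0 : c' != 0 by apply: contraNneq c0 => c'0; rewrite Ec c'0 mul0r.
apply: (IHn c' _ a' b') => //.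
  by rewrite -ltnS (leq_trans _ sc) // Ec size_Mmonic ?monicXsubC // size_XsubC addn2.
move: evc0; rewrite Ef Ea Eb Ec !rmorphM /= mulf_eq0 negb_or => /andP[].
move: (ev a') (ev b') (ev c') (ev ('X - al%:P)) => A B C0 X0 c1 d1.
by field; rewrite c1 d1.
Qed.

(** The element [eta] is in [O] since it is integral over [k[x]].  From a relation
    [U Delta + V Delta' = 1] between the coprime polynomials [Delta] and [Delta'],
    and from [2 d eta = Delta' dx / eta], one gets
    [dx / eta = U eta dx + 2 V d eta]. *)
Lemma invariant_form_regular (O : {pred F}) : valuation_ring iota O -> x \in O ->
  differential_over O (invariant_form x eta).
Proof.
case=> [[O1 OB OM] Oc _ OV] xO.
have O0 : 0 \in O by rewrite -(subrr 1) OB.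
have ON f : f \in O -> - f \in O by move=> fO; rewrite -sub0r OB.
have OD f g : f \in O -> g \in O -> f + g \in O.
  by move=> fO gO; rewrite -(opprK g) OB // ON.
have Oev p : ev p \in O.
  elim/poly_ind: p => [|p c IHp]; first by rewrite rmorph0.
  by rewrite rmorphD rmorphM /= pevalX pevalC OD ?OM.
have etaO : eta \in O.
  have [//|eO] := OV eta.
  have -> : eta = ev Delta * eta^-1 by rewrite -eta2; field.
  by rewrite OM.
have [_ _ _ _] := cover; rewrite unlock => /Bezout_eq1_coprimepP[[U V] /= E].
exists [:: (ev U * eta, x); (2 * ev V, eta)]; split.
  move=> ab; rewrite !inE => /orP[]/eqP-> /=; first by rewrite OM.
  by rewrite OM // -(rmorph_nat iota).
move=> D; rewrite !big_cons big_nil /=.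
have := congr1 ev E; rewrite rmorphD !rmorphM rmorph1 /= -eta2 => {}E.
rewrite addr0 -[LHS]mul1r -[X in X * _]E mulrDl.
by rewrite der_eta /invariant_form; field; rewrite etaN0 two0.
Qed.

End Affine.
End DoubleCoverDifferentials.

(** * Double covers with four branch points *)

Section DoubleCoverGenus.
Variables (k : numClosedFieldType) (F : fieldType) (iota : {rmorphism k -> F}).
Implicit Type D : derivation iota.

Section Derivation.
Variables (x eta : F) (Delta : {poly k}).
Hypothesis cover : double_cover iota x eta Delta.
Local Notation ev := (peval iota x).

Let tx : transcendental iota x. Proof. by case: cover. Qed.
Let eta2 : eta ^+ 2 = ev Delta. Proof. by case: cover. Qed.
Let etaN0 : eta != 0. Proof. exact: eta_neq0 cover. Qed.
Let two0 : 2 != 0 :> F. Proof. exact: two_neq0 iota. Qed.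

(** The derivative of [(a + b eta) / c] for the derivation with [x' = eta]: primed
    arguments are derivatives with respect to [x], hence multiplied by [eta], and
    [h] is the derivative [Delta' / 2] of [eta]. *)
Definition quotient_rule (a a' b b' c c' h : F) : F :=
  ((a' * eta + b' * eta ^+ 2 + b * h) * c - (a + b * eta) * (c' * eta)) / c ^+ 2.

Definition cover_derive a b c := quotient_rule (ev a) (ev a^`()) (ev b) (ev b^`())
  (ev c) (ev c^`()) (ev Delta^`() / 2).

Lemma quotient_rule_eq a a' b b' c c' a1 a1' b1 b1' c1 c1' h :
  c != 0 -> c1 != 0 -> a * c1 = a1 * c -> b * c1 = b1 * c ->
  a' * c1 + a * c1' = a1' * c + a1 * c' -> b' * c1 + b * c1' = b1' * c + b1 * c' ->
  quotient_rule a a' b b' c c' h = quotient_rule a1 a1' b1 b1' c1 c1' h.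
Proof.
move=> c0 c10 Ea Eb Ea' Eb'; rewrite /quotient_rule.
have -> : a = a1 * c / c1 by rewrite -Ea mulfK.
have -> : b = b1 * c / c1 by rewrite -Eb mulfK.
have -> : a' = (a1' * c + a1 * c' - (a1 * c / c1) * c1') / c1.
  by rewrite -Ea' -Ea mulfK // addrK mulfK.
have -> : b' = (b1' * c + b1 * c' - (b1 * c / c1) * c1') / c1.
  by rewrite -Eb' -Eb mulfK // addrK mulfK.
by field; rewrite c0 c10.
Qed.

Lemma quotient_ruleD a a' b b' c c' a1 a1' b1 b1' c1 c1' h : c != 0 -> c1 != 0 ->
  quotient_rule (a * c1 + a1 * c) (a' * c1 + a * c1' + (a1' * c + a1 * c'))
    (b * c1 + b1 * c) (b' * c1 + b * c1' + (b1' * c + b1 * c'))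
    (c * c1) (c' * c1 + c * c1') h =
  quotient_rule a a' b b' c c' h + quotient_rule a1 a1' b1 b1' c1 c1' h.
Proof. by move=> c0 c10; rewrite /quotient_rule; field; rewrite c0 c10. Qed.

Lemma quotient_ruleM a a' b b' c c' a1 a1' b1 b1' c1 c1' h : c != 0 -> c1 != 0 ->
  quotient_rule (a * a1 + b * b1 * eta ^+ 2)
    (a' * a1 + a * a1' + ((b' * b1 + b * b1') * eta ^+ 2 + b * b1 * (2 * h)))
    (a * b1 + b * a1) (a' * b1 + a * b1' + (b' * a1 + b * a1'))
    (c * c1) (c' * c1 + c * c1') h =
  (a + b * eta) / c * quotient_rule a1 a1' b1 b1' c1 c1' h +
  (a1 + b1 * eta) / c1 * quotient_rule a a' b b' c c' h.
Proof. by move=> c0 c10; rewrite /quotient_rule; field; rewrite c0 c10. Qed.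

Lemma cover_derive_eq a b c a1 b1 c1 : c != 0 -> c1 != 0 ->
  (ev a + ev b * eta) / ev c = (ev a1 + ev b1 * eta) / ev c1 ->
  cover_derive a b c = cover_derive a1 b1 c1.
Proof.
move=> c0 c10 /eqP; rewrite eqr_div ?transcendental_neq0 // => /eqP E.
have [Ea Eb] : a * c1 - a1 * c = 0 /\ b * c1 - b1 * c = 0.
  apply: (cover_free_poly cover); rewrite !(rmorphB, rmorphM) /=.
  by move/eqP: E; rewrite -subr_eq0 => /eqP <-; ring.
move/subr0_eq: Ea => Ea; move/subr0_eq: Eb => Eb.
have Ea' := congr1 deriv Ea; have Eb' := congr1 deriv Eb.
rewrite !derivM in Ea' Eb'.
move/(congr1 ev): Ea; move/(congr1 ev): Eb; move/(congr1 ev): Ea'; move/(congr1 ev): Eb'.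
rewrite !(rmorphD, rmorphM) /= => Eb' Ea' Eb Ea.
by apply: quotient_rule_eq; rewrite ?transcendental_neq0.
Qed.

(** The derivation is defined on chosen representatives [(a + b eta) / c]; the
    result is independent of the choice by cover_derive_eq.  It is dual to
    [dx / eta]. *)
Lemma cover_derivation : exists D, D x = eta.
Proof.
have repr f := cid (cover_repr cover f).
pose d f := let: exist a Ha := repr f in let: exist b Hb := cid Ha in
  let: exist c _ := cid Hb in cover_derive a b c.
have dE a b c : c != 0 -> d ((ev a + ev b * eta) / ev c) = cover_derive a b c.
  move=> c0; rewrite /d; case: (repr _) => a1 Ha; case: cid => b1 Hb.
  by case: cid => c1 [c10 E]; apply/esym/cover_derive_eq.
have dD f g : d (f + g) = d f + d g.
  have [a [b [c [c0 ->]]]] := cover_repr cover f.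
  have [a1 [b1 [c1 [c10 ->]]]] := cover_repr cover g.
  have e0 := transcendental_neq0 tx c0; have e10 := transcendental_neq0 tx c10.
  have -> : (ev a + ev b * eta) / ev c + (ev a1 + ev b1 * eta) / ev c1 =
     (ev (a * c1 + a1 * c) + ev (b * c1 + b1 * c) * eta) / ev (c * c1).
    rewrite !(rmorphD, rmorphM) /=.
    by move: (ev c) (ev c1) e0 e10 => v v1 v0 v10; field; rewrite v0 v10.
  rewrite !dE ?mulf_neq0 // /cover_derive !(derivM, derivD) !(rmorphD, rmorphM) /=.
  exact: quotient_ruleD.
have dM f g : d (f * g) = f * d g + g * d f.
  have [a [b [c [c0 ->]]]] := cover_repr cover f.
  have [a1 [b1 [c1 [c10 ->]]]] := cover_repr cover g.
  have e0 := transcendental_neq0 tx c0; have e10 := transcendental_neq0 tx c10.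
  have -> : (ev a + ev b * eta) / ev c * ((ev a1 + ev b1 * eta) / ev c1) =
     (ev (a * a1 + b * b1 * Delta) + ev (a * b1 + b * a1) * eta) / ev (c * c1).
    rewrite !(rmorphD, rmorphM) /= -eta2.
    by move: (ev c) (ev c1) e0 e10 => v v1 v0 v10; field; rewrite v0 v10.
  rewrite !dE ?mulf_neq0 // /cover_derive !(derivM, derivD) !(rmorphD, rmorphM) /= -eta2.
  rewrite -quotient_ruleM //.
  by have -> : 2 * (ev Delta^`() / 2) = ev Delta^`() by field; rewrite two0.
have dC c : d (iota c) = 0.
  have -> : iota c = (ev c%:P + ev 0 * eta) / ev 1.
    by rewrite pevalC rmorph0 rmorph1 divr1 mul0r addr0.
  rewrite dE ?oner_neq0 // /cover_derive !derivC !rmorph0 rmorph1 /quotient_rule.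
  by rewrite !mul0r !addr0 !(mul0r, mulr0) subr0 mul0r.
exists (Defs.Derivation dD dM dC) => /=.
have := dE 'X 0 1 (oner_neq0 _); rewrite pevalX rmorph0 rmorph1 mul0r addr0 divr1 => ->.
rewrite /cover_derive derivX deriv0 !(derivC 1) !rmorph0 rmorph1 /quotient_rule pevalX.
by rewrite !(mul0r, mul1r, addr0, subr0, mulr0, mulr1) expr1n divr1.
Qed.

End Derivation.

(** The other chart of the double cover: with [Delta] seen as a form of degree 4,
    the points over infinity are the points over the origin of the reversed
    curve. *)
Lemma cover_inv x eta Delta : double_cover iota x eta Delta ->
  (size Delta <= 5)%N -> separable_poly (revp 4 Delta) ->
  double_cover iota x^-1 (eta / x ^+ 2) (revp 4 Delta).
Proof.
move=> [tx eta2 etaN gen _] sD sep.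
have x0 := transcendental_self_neq0 tx; have xV0 : x^-1 != 0 by rewrite invr_eq0.
have sub := rational_in_subfield iota x; have [_ _ PM PV] := sub.
split=> //; first exact: transcendentalV.
- by rewrite peval_revp // invrK -eta2; field.
- move/rational_inVE => r; apply: etaN; have -> : eta = eta / x ^+ 2 * (x * x) by field.
  by apply: (PM) => //; apply: (PM); apply: rational_in_self.
- move=> P sP Px Pe; have [_ _ QM QV] := sP.
  have {}Px : P x by rewrite -(invrK x); apply: QV.
  apply: gen => //; have -> : eta = eta / x ^+ 2 * (x * x) by field.
  by apply: (QM) => //; apply: (QM).
Qed.

Lemma cover_regular x eta Delta u D0 : double_cover iota x eta Delta ->
  D0 x != 0 -> regular_differential u -> exists a b, forall D,
    u D = (peval iota x a + peval iota x b * eta) * invariant_form x eta D.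
Proof.
move=> cover Dx0 ru; have eta0 := eta_neq0 cover.
have om0 : invariant_form x eta D0 != 0 by rewrite mulf_neq0 ?invr_eq0.
have reg al ep Eep := cover_regular_local cover (al := al) (ep := ep) Eep ru.
have [f _ uf] := reg 0 _ (sqrtCK _).
have [|a [b Ef]] := everywhere_local_poly cover (f := f).
  move=> al ep /reg[f' f'O uf'].
  by rewrite (mulIf om0 (etrans (esym (uf D0)) (uf' D0))).
by exists a, b => D; rewrite uf Ef.
Qed.

(** In the chart at infinity [dx / eta] becomes its opposite, so that it is regular
    everywhere.  If [P(x) + Q(x) eta] times this form is regular, then the other
    chart gives [P(x) = - P'(1 / x)] and [x^2 Q(x) = - Q'(1 / x)] for polynomials
    [P'] and [Q'], whence [P] is constant and [Q = 0]. *)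
Lemma double_cover_genus1 x eta Delta : double_cover iota x eta Delta ->
  (size Delta <= 5)%N -> separable_poly (revp 4 Delta) -> field_genus iota 1.
Proof.
move=> cover sD sep; have cover' := cover_inv cover sD sep.
have [tx _ etaN _ _] := cover; have x0 := transcendental_self_neq0 tx.
have eta0 := eta_neq0 cover; have [D0 D0x] := cover_derivation cover.
have om1 : invariant_form x eta D0 = 1 by rewrite /invariant_form D0x divff.
have om_inv D : invariant_form x^-1 (eta / x ^+ 2) D = - invariant_form x eta D.
  by rewrite /invariant_form derV //; field; rewrite x0 eta0.
exists (fun _ => invariant_form x eta); split.
- move=> _; split=> [|O vO].
    exists [:: (eta^-1, x)]; split=> [ab _ //|D].
    by rewrite big_seq1 /invariant_form mulrC.
  have [_ _ _ /(_ x)[xO|xO]] := vO; first exact: (invariant_form_regular cover vO xO).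
  have [s [sO Es]] := invariant_form_regular cover' vO xO.
  exists [seq (- ab.1, ab.2) | ab <- s]; split.
    move=> _ /mapP[ab /sO[aO bO] ->] /=; split=> //.
    by have [[_ OB _] _ _ _] := vO; rewrite -sub0r OB // -(subrr ab.1) OB.
  move=> D; apply: oppr_inj; rewrite -om_inv Es big_map -sumrN.
  by apply: eq_bigr => ab _; rewrite mulNr opprK.
- move=> c /(_ D0) c0 i; rewrite (ord1 i); apply/eqP.
  by move/eqP: c0; rewrite big_ord1 om1 mulr1 fmorph_eq0.
- move=> u ru.
  have [|a [b ab]] := cover_regular cover (D0 := D0) _ ru; first by rewrite D0x.
  have [|a' [b' ab']] := cover_regular cover' (D0 := D0) _ ru.
    by rewrite derV // D0x mulf_neq0 ?oppr_eq0 ?invr_eq0 ?expf_neq0.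
  have sub := rational_in_subfield iota x; have [_ PD PM PV] := sub.
  have ratV p : rational_in iota x (peval iota x^-1 p).
    by apply/rational_inVE/rational_in_peval.
  have [|||Ea Eb] := @rational_free _ _ iota x eta (peval iota x a + peval iota x^-1 a')
    (peval iota x b + peval iota x^-1 b' * (x^-1 * x^-1)) etaN.
  - by apply: PD => //; apply: rational_in_peval.
  - apply: PD; first exact: rational_in_peval.
    by apply: (PM) => //; apply: (PM); apply: rational_inV.
  - have := ab' D0; rewrite ab om_inv om1 mulr1 mulrN1 => /eqP.
    rewrite -subr_eq0 opprK => /eqP <-.
    by field.
  have a1 : (size a <= 1)%N.
    have [|//] := @peval_eqV _ _ _ _ a (- a') 0 tx.
    by rewrite mulr1 rmorphN; apply/eqP; rewrite -addr_eq0 Ea.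
  have b0 : b = 0.
    have [|_ -> //] := @peval_eqV _ _ _ _ b (- b') 2 tx.
    rewrite rmorphN; apply/eqP; rewrite -addr_eq0 -(mul0r (x ^+ 2)) -Eb.
    by apply/eqP; field.
  exists (fun _ => a`_0) => D; rewrite big_ord1 ab b0 rmorph0 mul0r addr0.
  by rewrite (size1_polyC a1) pevalC coefC.
Qed.
End DoubleCoverGenus.

(** * Real roots of the discriminant *)

Section Quartic.
Variable R : rcfType.

Definition quad a0 a1 a2 : {poly R} := a0%:P + a1 *: 'X + a2 *: 'X^2.

Lemma horner_quad a0 a1 a2 x : (quad a0 a1 a2).[x] = a0 + a1 * x + a2 * x ^+ 2.
Proof. by rewrite !hornerE. Qed.

(** The discriminant of [c x^2 - (y - b) x + a], with [a], [b], [c] polynomials in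
    the variable ['X = y]. *)
Definition quad_disc (a b c : {poly R}) : {poly R} := ('X - b) ^+ 2 - 4 * a * c.

Lemma horner_quad_disc a b c x :
  (quad_disc a b c).[x] = (x - b.[x]) ^+ 2 - 4 * a.[x] * c.[x].
Proof. by rewrite !hornerE /=; ring. Qed.

(** At [y = 1] the quantities [a], [b], [c] are nonnegative with [a + b + c < 1],
    and [(1 - b)^2 > (a + c)^2 >= 4 a c]; at [y = -1] the absolute
    values of [a], [b], [c] are bounded by their values at [1]. *)
Lemma quad_disc_gt0 a0 a1 a2 b0 b1 b2 c0 c1 c2 x :
  [/\ 0 <= a0, 0 <= a1 & 0 <= a2] -> [/\ 0 <= b0, 0 <= b1 & 0 <= b2] ->
  [/\ 0 <= c0, 0 <= c1 & 0 <= c2] ->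
  a0 + a1 + a2 + (b0 + b1 + b2) + (c0 + c1 + c2) < 1 -> x ^+ 2 = 1 ->
  0 < (quad_disc (quad a0 a1 a2) (quad b0 b1 b2) (quad c0 c1 c2)).[x].
Proof.
move=> [ha0 ha1 ha2] [hb0 hb1 hb2] [hc0 hc1 hc2] sum_lt1 x1; rewrite horner_quad_disc !horner_quad.
have [->|->] : x = 1 \/ x = -1.
  have : (x - 1) * (x + 1) == 0 by apply/eqP; rewrite -(subrr (x ^+ 2)) {2}x1; ring.
  by rewrite mulf_eq0 subr_eq0 addr_eq0 => /orP[]/eqP->; [left|right].
- have : 0 <= a0 + a1 + a2 by lra.
  have : 0 <= c0 + c1 + c2 by lra.
  have : 0 < 1 - (b0 + b1 + b2) - (a0 + a1 + a2) - (c0 + c1 + c2) by lra.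
  rewrite !mulr1 !expr1n !mulr1.
  move: (a0 + a1 + a2) (b0 + b1 + b2) (c0 + c1 + c2) => a b c h hc ha.
  have -> : (1 - b) ^+ 2 - 4 * a * c = (1 - b - a - c) * (1 - b + a + c) + (a - c) ^+ 2 by ring.
  by rewrite ltr_pwDl ?sqr_ge0 // mulr_gt0 //; lra.
- pose u := 1 + (b0 - b1 + b2); pose al := a0 - a1 + a2; pose ga := c0 - c1 + c2.
  have -> : (-1 - (b0 + b1 * -1 + b2 * (-1) ^+ 2)) ^+ 2 -
     4 * (a0 + a1 * -1 + a2 * (-1) ^+ 2) * (c0 + c1 * -1 + c2 * (-1) ^+ 2) =
     (u - (al + ga)) * (u + (al + ga)) + (al - ga) ^+ 2 by rewrite /u /al /ga; ring.
  by rewrite ltr_pwDl ?sqr_ge0 // mulr_gt0 // /u /al /ga; lra.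
Qed.

Lemma roots_around (Delta : {poly R}) x : 0 < Delta.[1] -> 0 < Delta.[-1] ->
  0 <= x < 1 -> Delta.[x] < 0 ->
  exists r1 r2, [/\ -1 < r1, r1 < r2, r2 < 1, root Delta r1 & root Delta r2].
Proof.
move=> D1 Dm1 /andP[x0 x1] Dx.
have [|r2 /andP[xr2 r21] root2] := poly_ivt (ltW x1) (p := Delta).
  by rewrite !ltW.
have [||r1 /andP[mr1 r1x] root1] := @poly_ivt _ (- Delta) (-1) x; first by lra.
  by rewrite !hornerN oppr_le0 oppr_ge0 !ltW.
rewrite rootN in root1; exists r1, r2; split=> //.
- by rewrite lt_neqAle mr1 andbT; apply: contraTneq root1 => <-; rewrite rootE gt_eqF.
- have xr2' : x < r2.
    by rewrite lt_neqAle xr2 andbT; apply: contraTneq root2 => <-; rewrite rootE lt_eqF.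
  exact: le_lt_trans xr2'.
- by rewrite lt_neqAle r21 andbT; apply: contraTneq root2 => ->; rewrite rootE gt_eqF.
Qed.

Lemma quad_gt0 a0 a1 a2 x : 0 <= a0 -> 0 <= a1 -> 0 <= a2 -> 0 < x ->
  ~ [/\ a0 = 0, a1 = 0 & a2 = 0] -> 0 < (quad a0 a1 a2).[x].
Proof.
move=> ha0 ha1 ha2 x0 aN; rewrite horner_quad.
have h1 : 0 <= a1 * x by rewrite mulr_ge0 // ltW.
have h2 : 0 <= a2 * x ^+ 2 by rewrite mulr_ge0 // exprn_ge0 // ltW.
rewrite lt_neqAle !addr_ge0 // andbT eq_sym; apply/eqP => E; apply: aN.
have [E0 [E1 E2]] : a0 = 0 /\ a1 * x = 0 /\ a2 * x ^+ 2 = 0 by split; [|split]; lra.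
split=> //.
  by move/eqP: E1; rewrite mulf_eq0 (gt_eqF x0) orbF => /eqP.
by move/eqP: E2; rewrite mulf_eq0 expf_eq0 (gt_eqF x0) andbF orbF => /eqP.
Qed.

(** When [Delta] vanishes at the origin its derivative there is negative, which
    provides a negative value to the right of the origin. *)
Lemma roots_at0 a1 a2 b1 b2 c0 c1 c2 :
  0 <= a1 -> 0 <= c0 ->
  a1 <> 0 -> c0 <> 0 ->
  let Delta := quad_disc (quad 0 a1 a2) (quad 0 b1 b2) (quad c0 c1 c2) in
  0 < Delta.[1] ->
  exists r1 r2, [/\ -1 < r1, r1 < r2, r2 < 1, root Delta r1 & root Delta r2].
Proof.
move=> a1_ge0 c0_ge0 /eqP a1N /eqP c0N Delta D1.
pose D := 'X * (1 - b1%:P - b2 *: 'X) ^+ 2 - 4 * (a1%:P + a2 *: 'X) * quad c0 c1 c2.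
have ED : Delta = 'X * D.
  by rewrite /Delta /D /quad_disc /quad -!mul_polyC polyC0; ring.
have D11 : 0 < D.[1] by move: D1; rewrite ED hornerM hornerX mul1r.
have D0 : D.[0] < 0.
  have -> : D.[0] = - (4 * (a1 * c0)) by rewrite !hornerE /=; ring.
  rewrite oppr_lt0.
  by rewrite !mulr_gt0 // ?lt0r ?a1N ?c0N.
have [|r /andP[r0 r1] rootr] := poly_ivt ler01 (p := D).
  by rewrite !ltW.
exists 0, r; split=> //.
- by rewrite oppr_lt0.
- by rewrite lt_neqAle r0 andbT; apply: contraTneq rootr => <-; rewrite rootE lt_eqF.
- by rewrite lt_neqAle r1 andbT; apply: contraTneq rootr => ->; rewrite rootE gt_eqF.
- by rewrite ED rootM rootX eqxx.
- by rewrite ED rootM rootr orbT.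
Qed.

Lemma quad_discC (a b c : {poly R}) : quad_disc a b c = quad_disc c b a.
Proof. by rewrite /quad_disc; ring. Qed.

(** The polynomial [y - b(y)] has a root in the interval from [0] to [1] by its
    signs at the ends.  At this root [Delta = - 4 a c], which is negative if
    the root is positive, and [Delta] is positive at [1] and [-1].  If the root is
    [0] and [a c] vanishes there, the origin is a simple root of [Delta]. *)
Lemma two_roots a0 a1 a2 b0 b1 b2 c0 c1 c2 :
  [/\ 0 <= a0, 0 <= a1 & 0 <= a2] -> [/\ 0 <= b0, 0 <= b1 & 0 <= b2] ->
  [/\ 0 <= c0, 0 <= c1 & 0 <= c2] ->
  a0 + a1 + a2 + (b0 + b1 + b2) + (c0 + c1 + c2) < 1 ->
  ~ [/\ a0 = 0, a1 = 0 & a2 = 0] -> ~ [/\ c0 = 0, c1 = 0 & c2 = 0] ->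
  ~ [/\ a0 = 0, b0 = 0 & c0 = 0] ->
  ~ [/\ a0 = 0, a1 = 0 & b0 = 0] -> ~ [/\ c0 = 0, c1 = 0 & b0 = 0] ->
  let Delta := quad_disc (quad a0 a1 a2) (quad b0 b1 b2) (quad c0 c1 c2) in
  exists r1 r2, [/\ -1 < r1, r1 < r2, r2 < 1, root Delta r1 & root Delta r2].
Proof.
move=> [ha0 ha1 ha2] [hb0 hb1 hb2] [hc0 hc1 hc2] sum_lt1 aN cN y0N caN ccN Delta.
have D1 : 0 < Delta.[1] by apply: quad_disc_gt0; rewrite ?expr1n.
have around x : 0 <= x < 1 -> Delta.[x] < 0 -> exists r1 r2,
  [/\ -1 < r1, r1 < r2, r2 < 1, root Delta r1 & root Delta r2].
  by apply: roots_around => //; apply: quad_disc_gt0; rewrite ?sqrrN ?expr1n.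
have [|y /andP[y0 y1] rooty] := @poly_ivt _ ('X - quad b0 b1 b2) 0 1 ler01.
  rewrite !hornerD !hornerN !hornerX !horner_quad; apply/andP; split; lra.
have Ey : y = (quad b0 b1 b2).[y].
  by apply/eqP; rewrite -subr_eq0; move: rooty; rewrite rootE hornerD hornerN hornerX.
have {}y1 : y < 1.
  rewrite lt_neqAle y1 andbT; apply/eqP => Ey1; move: Ey; rewrite Ey1 horner_quad => ?; lra.
have Dy : Delta.[y] = - (4 * (quad a0 a1 a2).[y] * (quad c0 c1 c2).[y]).
  by rewrite horner_quad_disc -Ey; ring.
have [y00|yN0] := eqVneq y 0; last first.
  have {}y0 : 0 < y by rewrite lt_neqAle eq_sym yN0.
  apply: (around y); first by rewrite y1 ltW.
  by rewrite Dy oppr_lt0 !mulr_gt0 // quad_gt0.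
have b00 : b0 = 0 by move: Ey; rewrite horner_quad y00; lra.
have [a00|a0N] := eqVneq a0 0.
  rewrite /Delta a00 b00; apply: roots_at0 => //.
  - by move=> a10; apply: caN.
  - by move=> c00; apply: y0N.
  - by move: D1; rewrite /Delta a00 b00.
have [c00|c0N] := eqVneq c0 0.
  rewrite /Delta c00 b00 quad_discC; apply: roots_at0 => //.
  - by move=> c10; apply: ccN.
  - by move/eqP: a0N.
  - by move: D1; rewrite /Delta c00 b00 quad_discC.
apply: (around 0); first by rewrite lexx ltr01.
have -> : Delta.[0] = - (4 * a0 * c0).
  by rewrite horner_quad_disc !horner_quad b00; ring.
by rewrite oppr_lt0 !mulr_gt0 // lt0r ?a0N ?c0N.
Qed.

Lemma separable_of_roots (p : {poly R}) (rs : seq R) : p != 0 ->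
  all (root p) rs -> uniq rs -> (size p <= (size rs).+1)%N -> separable_poly p.
Proof.
move=> p0 rp urs sp; have := max_poly_roots p0 rp urs => lt.
have Es : size p = (size rs).+1 by apply/eqP; rewrite eqn_leq sp lt.
rewrite (all_roots_prod_XsubC Es rp) ?uniq_rootsE //.
have l0 : lead_coef p != 0 by rewrite lead_coef_eq0.
rewrite unlock derivZ coprimepZl // coprimepZr //.
by have := separable_prod_XsubC rs; rewrite unlock => ->.
Qed.

(** The inverses of the roots of the reversed polynomial are roots outside the
    interval, and a root [0] of the reversed polynomial lowers the degree
    instead.  In each case there are as many distinct roots as the degree. *)
Lemma separable_quartic (p : {poly R}) : p != 0 -> (size p <= 5)%N ->
  (exists r1 r2, [/\ -1 < r1, r1 < r2, r2 < 1, root p r1 & root p r2]) ->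
  (exists s1 s2, [/\ -1 < s1, s1 < s2, s2 < 1, root (revp 4 p) s1 & root (revp 4 p) s2]) ->
  separable_poly p.
Proof.
move=> p0 sp [r1 [r2 [r1m r12 r21 root1 root2]]] [s1 [s2 [s1m s12 s21 roots1 roots2]]].
have rootV (s : R) : s != 0 -> root (revp 4 p) s -> root p s^-1.
  by move=> s0; rewrite !rootE horner_revp // mulf_eq0 expf_eq0 (negPf s0).
have out (s r : R) : -1 < s < 1 -> s != 0 -> -1 < r < 1 -> r != s^-1.
  move=> /andP[sm s1'] s0 /andP[rm r1']; apply/eqP => rs.
  have : r * s = 1 by rewrite rs mulVf.
  nra.
have size4 (s : R) : s = 0 -> root (revp 4 p) s -> (size p <= 4)%N.
  move=> ->; rewrite rootE horner_coef0 coef_poly subn0 => /eqP p4.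
  apply/leq_sizeP=> j; rewrite leq_eqVlt => /orP[/eqP<- //|j5].
  by rewrite nth_default // (leq_trans sp).
have ir1 : -1 < r1 < 1 by lra.
have ir2 : -1 < r2 < 1 by lra.
have is1 : -1 < s1 < 1 by lra.
have is2 : -1 < s2 < 1 by lra.
have [s10|s10] := eqVneq s1 0.
  have s20 : s2 != 0 by rewrite -s10 gt_eqF.
  apply: (@separable_of_roots p [:: r1; r2; s2^-1]) => //=.
  - by rewrite root1 root2 rootV.
  - by rewrite !inE !negb_or (lt_eqF r12) !out.
  - exact: size4 roots1.
have [s20|s20] := eqVneq s2 0.
  apply: (@separable_of_roots p [:: r1; r2; s1^-1]) => //=.
  - by rewrite root1 root2 rootV.
  - by rewrite !inE !negb_or (lt_eqF r12) !out.
  - exact: size4 roots2.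
apply: (@separable_of_roots p [:: r1; r2; s1^-1; s2^-1]) => //=.
- by rewrite root1 root2 !rootV.
- rewrite !inE !negb_or (lt_eqF r12) (inj_eq invr_inj) (lt_eqF s12).
  by rewrite (out s1 r1) // (out s2 r1) // (out s1 r2) // (out s2 r2).
Qed.

Lemma size_quad a0 a1 a2 : (size (quad a0 a1 a2) <= 3)%N.
Proof.
apply/leq_sizeP=> j j3; rewrite !coefD !coefZ coefC coefX coefXn.
by case: j j3 => [|[|[|j]]] //= _; rewrite !mulr0 !addr0.
Qed.

Lemma quad_disc_coefs a0 a1 a2 b0 b1 b2 c0 c1 c2 :
  quad_disc (quad a0 a1 a2) (quad b0 b1 b2) (quad c0 c1 c2) =
  \poly_(i < 5) [:: b0 ^+ 2 - 4 * a0 * c0;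
    - 2 * b0 * (1 - b1) - 4 * (a0 * c1 + a1 * c0);
    (1 - b1) ^+ 2 + 2 * b0 * b2 - 4 * (a0 * c2 + a1 * c1 + a2 * c0);
    - 2 * b2 * (1 - b1) - 4 * (a2 * c1 + a1 * c2);
    b2 ^+ 2 - 4 * a2 * c2]`_i.
Proof.
rewrite poly_def !big_ord_recl big_ord0 /= /bump /= /quad_disc /quad -!mul_polyC.
rewrite !(polyCN, polyCB, polyCD, polyCM, polyC_exp, polyC_natr).
by ring.
Qed.

Lemma quad_disc_rev a0 a1 a2 b0 b1 b2 c0 c1 c2 :
  revp 4 (quad_disc (quad a0 a1 a2) (quad b0 b1 b2) (quad c0 c1 c2)) =
  quad_disc (quad a2 a1 a0) (quad b2 b1 b0) (quad c2 c1 c0).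
Proof.
rewrite !quad_disc_coefs; apply/polyP=> i; rewrite coef_poly [RHS]coef_poly.
case: ltnP => // i5; rewrite coef_poly ltnS leq_subr.
by case: i i5 => [|[|[|[|[|i]]]]] //= _; ring.
Qed.

Lemma size_quad_disc a0 a1 a2 b0 b1 b2 c0 c1 c2 :
  (size (quad_disc (quad a0 a1 a2) (quad b0 b1 b2) (quad c0 c1 c2)) <= 5)%N.
Proof. by rewrite quad_disc_coefs size_poly. Qed.

End Quartic.

(** * Irreducibility of quadratic polynomials over k[y] *)

Section BivariateFactorization.
Variable k : closedFieldType.
Implicit Types (a b c u v : {poly k}) (P U V : {poly {poly k}}).

(** The factors [y - be] are the primes of [k[y]], and they remain primes of
    [k[y][x]] because reduction at [be] has values in a domain. *)
Lemma dvd_XsubC_coefs (be : k) U : map_poly (horner_eval be) U = 0 ->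
  exists U', U = ('X - be%:P)%:P * U'.
Proof.
move=> U0; exists (\poly_(i < size U) (U`_i %/ ('X - be%:P))).
apply/polyP=> i; rewrite coefCM coef_poly; case: ltnP => [_|leUi].
  rewrite mulrC divpK // dvdp_XsubCl rootE.
  by have /polyP/(_ i) := U0; rewrite coef_map coef0 /= => /eqP.
by rewrite nth_default // mulr0.
Qed.

(** Linear factors of [c] are removed one at a time: each is prime in [k[y][x]], and
    divides [U] or [V]. *)
Lemma gauss c P U V : c != 0 -> c%:P * P = U * V ->
  exists c1 c2 U1 V1, [/\ c1 != 0, c2 != 0, U = c1%:P * U1, V = c2%:P * V1 & P = U1 * V1].
Proof.
elim: {c}(size c).+1 {-2}c (ltnSn (size c)) U V => // n IHn c sc U V c0 E.
have [/size_poly1P[e e0 Ec]|/closed_rootP[be rc]] := boolP (size c == 1%N).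
  have eK : e%:P%:P * (e^-1)%:P%:P = 1 :> {poly {poly k}}.
    by rewrite -!rmorphM divff.
  have cP0 : c%:P != 0 :> {poly {poly k}} by rewrite polyC_eq0.
  exists c, 1, ((e^-1)%:P%:P * U), V; rewrite c0 oner_neq0 mul1r; split=> //.
    by rewrite Ec mulrA eK mul1r.
  by apply: (mulfI cP0); rewrite E Ec !mulrA eK mul1r.
have /factor_theorem[c' Ec] := rc.
have X0 : ('X - be%:P)%:P != 0 :> {poly {poly k}} by rewrite polyC_eq0 polyXsubC_eq0.
have c'0 : c' != 0 by apply: contraNneq c0 => c'0; rewrite Ec c'0 mul0r.
have sc' : (size c' < n)%N.
  by rewrite -ltnS (leq_trans _ sc) // Ec size_Mmonic ?monicXsubC // size_XsubC addn2.
have : map_poly (horner_eval be) U * map_poly (horner_eval be) V = 0.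
  by rewrite -rmorphM -E rmorphM /= map_polyC /= /horner_eval (rootP rc) polyC0 mul0r.
have Xc c1 : c1 != 0 -> ('X - be%:P) * c1 != 0.
  by move=> c10; rewrite mulf_neq0 ?polyXsubC_eq0.
move/eqP; rewrite mulf_eq0 => /orP[]/eqP/dvd_XsubC_coefs[W EW].
  have [|c1 [c2 [W1 [V1 [c10 c20 E1 E2 E3]]]]] := IHn c' sc' W V c'0.
    by apply: (mulfI X0); rewrite [RHS]mulrA -EW -E Ec polyCM; ring.
  exists (('X - be%:P) * c1), c2, W1, V1; split=> //; first exact: Xc.
  by rewrite EW E1 polyCM mulrA.
have [|c1 [c2 [U1 [W1 [c10 c20 E1 E2 E3]]]]] := IHn c' sc' U W c'0.
  by apply: (mulfI X0); rewrite [RHS]mulrCA -EW -E Ec polyCM; ring.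
exists c1, (('X - be%:P) * c2), U1, W1; split=> //; first exact: Xc.
by rewrite EW E2 polyCM mulrA.
Qed.

Definition xquad a b c : {poly {poly k}} := a%:P + b%:P * 'X + c%:P * 'X^2.

Definition xdisc a b c := b ^+ 2 - 4 * a * c.

Lemma coef_xquad a b c i : (xquad a b c)`_i =
  if i == 0%N then a else if i == 1%N then b else if i == 2%N then c else 0.
Proof.
rewrite /xquad !coefD !coefCM coefC coefX coefXn.
by case: i => [|[|[|i]]] //=; rewrite ?(mulr0, mulr1, addr0, add0r).
Qed.

Lemma size_xquad a b c : c != 0 -> size (xquad a b c) = 3%N.
Proof.
move=> c0; apply/eqP; rewrite eqn_leq; apply/andP; split.
  by apply/leq_sizeP => i i3; rewrite coef_xquad; case: i i3 => [|[|[|i]]].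
rewrite ltnNge; apply/negP => /leq_sizeP/(_ 2 isT).
by rewrite coef_xquad /=; apply/eqP.
Qed.

Lemma size_coef_xquad n a b c i : (size a <= n)%N -> (size b <= n)%N -> (size c <= n)%N ->
  (size ((xquad a b c)`_i)%R <= n)%N.
Proof. by move=> sa sb sc; rewrite coef_xquad; case: i => [|[|[|i]]] //=; rewrite size_poly0. Qed.

Lemma nonunit_size (A : idomainType) (p : {poly A}) : size p != 1%N -> p \isn't a GRing.unit.
Proof. by move=> sp; rewrite poly_unitE (negPf sp). Qed.

(** A root [u / v] of [c x^2 + b x + a] in [k(y)] gives the factorisation
    [v^2 K = (v x - u) (c v x + (c u + b v))] into linear polynomials, which descends
    to [k[y][x]] by gauss. *)
Lemma irreducible_no_root a b c u v : ~ reducible (xquad a b c) -> c != 0 -> v != 0 ->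
  c * u ^+ 2 + b * u * v + a * v ^+ 2 != 0.
Proof.
move=> irr c0 v0; apply/eqP => E; apply: irr.
pose U := v%:P * 'X - u%:P; pose V := (c * v)%:P * 'X + (c * u + b * v)%:P.
have EUV : (v ^+ 2)%:P * xquad a b c = U * V.
  apply/eqP; rewrite -subr_eq0 /U /V /xquad.
  rewrite !(rmorphD, rmorphXn, rmorphM) /=.
  have -> : 0 = (c * u ^+ 2 + b * u * v + a * v ^+ 2)%:P by rewrite E polyC0.
  by rewrite !(rmorphD, rmorphXn, rmorphM) /=; apply/eqP; ring.
have [|c1 [c2 [U1 [V1 [c10 c20 E1 E2 E3]]]]] := gauss _ EUV.
  by rewrite expf_neq0.
have sizeM (d : {poly k}) W : d != 0 -> size (d%:P * W) = size W.
  by move=> d0; rewrite mul_polyC size_scale.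
exists U1, V1; split=> //; apply: nonunit_size.
  rewrite -(sizeM c1) // -E1 /U size_polyDl.
    by rewrite size_mulX ?polyC_eq0 // size_polyC v0.
  by rewrite size_mulX ?polyC_eq0 // size_polyN !size_polyC v0; case: (u != 0).
rewrite -(sizeM c2) // -E2 /V size_polyDl.
  by rewrite size_mulX ?polyC_eq0 ?mulf_neq0 // size_polyC mulf_neq0.
by rewrite size_mulX ?polyC_eq0 ?mulf_neq0 // !size_polyC mulf_neq0 //; case: (_ != 0).
Qed.

(** A factor in [k[y]] divides [a], [b] and [c], so that its square divides the
    discriminant; and if [K] is a product of two linear polynomials in [x], the
    discriminant is a square. *)
Lemma separable_irreducible a b c : c != 0 -> (1 < size (xdisc a b c))%N ->
  separable_poly (xdisc a b c) -> ~ reducible (xquad a b c).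
Proof.
move=> c0 sD sep [U [V [Un Vn E]]].
have nosq (u : {poly k}) : u ^+ 2 %| xdisc a b c -> size u == 1%N.
  by apply: contraTT => su; rewrite separable_nosquare.
have K0 : xquad a b c != 0 by rewrite -size_poly_eq0 size_xquad.
have U0 : U != 0 by apply: contraNneq K0 => U0; rewrite E U0 mul0r.
have V0 : V != 0 by apply: contraNneq K0 => V0; rewrite E V0 mulr0.
have sUV : (size U + size V = 4)%N.
  have := size_mul U0 V0; rewrite -E size_xquad //.
  have := size_poly_gt0 U; rewrite U0; case: (size U) => // n _ /=.
  by rewrite addSn /= => <-.
have const (W W' : {poly {poly k}}) : W \isn't a GRing.unit -> xquad a b c = W * W' ->
    size W != 1%N.
  move=> Wn EW; apply/negP => /size_poly1P[w w0 Ew]; apply/negP: Wn.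
  rewrite negbK poly_unitE Ew size_polyC w0 coefC eqxx /=.
  have coefs i : (xquad a b c)`_i = w * W'`_i by rewrite EW Ew coefCM.
  have := coefs 0%N; have := coefs 1%N; have := coefs 2%N; rewrite !coef_xquad /= => E2 E1 E0.
  rewrite poly_unitE; have sw : size w == 1%N.
    apply: nosq; apply/dvdpP; exists (W'`_1 ^+ 2 - 4 * W'`_0 * W'`_2).
    by rewrite /xdisc E0 E1 E2; ring.
  by rewrite sw /=; have /size_poly1P[e e0 ->] := sw; rewrite coefC eqxx unitfE.
have sU := const U V Un E; have sV := const V U Vn (etrans E (mulrC _ _)).
have [sU2 sV2] : size U = 2%N /\ size V = 2%N.
  move: sUV sU sV U0 V0; rewrite -!size_poly_gt0.
  by case: (size U) (size V) => [|[|[|[|[|?]]]]] [|[|[|[|[|?]]]]].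
pose u0 := U`_0; pose u1 := U`_1; pose v0 := V`_0; pose v1 := V`_1.
have U2 : U`_2 = 0 by rewrite nth_default ?sU2.
have V2 : V`_2 = 0 by rewrite nth_default ?sV2.
have Ea : a = u0 * v0.
  by have := congr1 (fun P : {poly {poly k}} => P`_0) E; rewrite coef_xquad coef0M.
have Eb : b = u0 * v1 + u1 * v0.
  have := congr1 (fun P : {poly {poly k}} => P`_1) E.
  by rewrite coef_xquad coefM !big_ord_recl big_ord0 addr0.
have Ec : c = u1 * v1.
  have := congr1 (fun P : {poly {poly k}} => P`_2) E.
  rewrite coef_xquad coefM !big_ord_recl big_ord0 addr0 /= /bump /= U2 V2.
  by rewrite mulr0 mul0r add0r addr0.
have ED : xdisc a b c = (u0 * v1 - u1 * v0) ^+ 2 by rewrite /xdisc Ea Eb Ec; ring.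
have /size_poly1P[e e0 Ee] : size (u0 * v1 - u1 * v0) == 1%N by apply: nosq; rewrite ED.
by move: sD; rewrite ED Ee -rmorphXn /= size_polyC; case: (_ != 0).
Qed.

End BivariateFactorization.

(** * The field k(y)(x) *)

Section KernelField.
Variable k : numClosedFieldType.
Implicit Types (a b c u v : {poly k}).

(** The function field of the curve [c x^2 + b x + a = 0]. *)
Definition kernel_field (F : fieldType) (iota : {rmorphism k -> F}) a b c (x y : F) :=
  [/\ transcendental iota y, ~ rational_in iota y x, generated_by iota x y &
    peval iota y c * x ^+ 2 + peval iota y b * x + peval iota y a = 0].

Lemma fraction_rep (A : idomainType) (f : {fraction A}) :
  exists n d, d != 0 /\ f = tofrac n / tofrac d.
Proof.
elim/quotW: f => r; have d0 := denom_ratioP r.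
exists (frac r).1, (frac r).2; split=> //.
have dF : tofrac (frac r).2 != 0 by rewrite tofrac_eq0.
apply: (canRL (mulfK dF)); unlock FracField.tofrac.
rewrite -[LHS]FracField.pi_mul; apply/eqmodP.
rewrite /= FracField.equivfE /FracField.mulf !numden_Ratio ?(oner_neq0, mulf_neq0) //.
by rewrite !mulr1 mulrC.
Qed.

(** The field is the extension of [k(y)] by a root of [K], which has no root in
    [k(y)] by irreducible_no_root. *)
Lemma kernel_field_exists a b c : c != 0 -> ~ reducible (xquad a b c) ->
  exists (F : fieldType) (iota : {rmorphism k -> F}) (x y : F),
    kernel_field iota a b c x y.
Proof.
move=> c0 irr.
pose F0 : fieldType := {fraction {poly k}}; pose tf : {rmorphism {poly k} -> F0} := @tofrac _.
have tf0 p : (tf p == 0) = (p == 0) := tofrac_eq0 p.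
pose K : {poly F0} := (tf a)%:P + tf b *: 'X + tf c *: 'X^2.
have K2 : K`_2 = tf c.
  by rewrite /K !coefD !coefZ coefC coefX coefXn mulr0 mulr1 !add0r.
have sK : size K = 3%N.
  apply/eqP; rewrite eqn_leq; apply/andP; split.
    apply/leq_sizeP => i; rewrite /K !coefD !coefZ coefC coefX coefXn.
    by case: i => [|[|[|i]]] //= _; rewrite !mulr0 !addr0.
  by rewrite ltnNge; apply/negP => /leq_sizeP/(_ 2 isT)/eqP; rewrite K2 tf0 (negPf c0).
have KE (r : F0) : K.[r] = tf c * r ^+ 2 + tf b * r + tf a.
  by rewrite /K !hornerD !hornerZ hornerC hornerX hornerXn; ring.
have noroot r : ~~ root K r.
  have [u [v [v0 Er]]] := fraction_rep r; apply/negP; rewrite rootE KE => /eqP E.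
  have v0' : tf v != 0 by rewrite tf0.
  have Euv : tf u = r * tf v by rewrite Er divfK.
  have := irreducible_no_root u irr c0 v0; rewrite -tf0 => /eqP; apply.
  rewrite !rmorphD [tf (a * _)]rmorphM ![tf (_ * v)]rmorphM ![tf (_ * u)]rmorphM.
  rewrite [tf (c * _)]rmorphM ![tf (_ ^+ 2)]rmorphXn Euv -(mul0r (tf v ^+ 2)) -E.
  by ring.
have [|L _ [z rz genz]] := @irredp_FAdjoin _ K.
  by apply: cubic_irreducible; rewrite ?sK.
pose ia : {rmorphism F0 -> L} := in_alg L.
pose iota : {rmorphism k -> L} := ia \o tf \o polyC.
pose y : L := ia (tf 'X).
have evE p : peval iota y p = ia (tf p).
  elim/poly_ind: p => [|p e IHp]; first by rewrite !rmorph0.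
  by rewrite !rmorphD !rmorphM /= IHp pevalX pevalC.
have ty : transcendental iota y.
  by move=> p; rewrite evE => /eqP; rewrite fmorph_eq0 tf0 => /eqP.
exists L, iota, z, y; split=> //.
- move=> [p [q [q0 Ez]]]; move: rz; rewrite Ez !evE -fmorph_div fmorph_root.
  by apply/negP/noroot.
- move=> P sP Pz Py f; have [PC _ PM PV] := sP.
  have : f \in <<1; z>>%VS by rewrite genz memvf.
  move=> /Fadjoin_polyP[p /polyOverP pO ->].
  rewrite horner_coef; apply: (subfield_sum _ sP) => i.
  apply: (PM); last exact: (subfieldX _ sP Pz).
  have /vlineP[r ->] := pO i; have [u [v [v0 ->]]] := fraction_rep r.
  rewrite -[_ *: 1]/(ia _) fmorph_div -!evE.
  by apply: (PM); [|apply: (PV)]; exact: (subfield_peval _ sP Py).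
- have Kz : (map_poly ia K).[z] = ia (tf c) * z ^+ 2 + ia (tf b) * z + ia (tf a).
    rewrite /K !rmorphD /= map_polyC !map_polyZ map_polyX map_polyXn.
    by rewrite !hornerD !hornerZ hornerC hornerX hornerXn addrC [X in _ + X = _]addrC addrA.
  by rewrite !evE -Kz; apply/eqP.
Qed.

End KernelField.

(** * Bihomogeneous forms *)

Section Homogenization.
Variable K : fieldType.
Implicit Types (p q : {poly K}) (u v : K) (G H : {poly {poly K}}).

(** The form of degree [n] attached to [p], evaluated at the point [u : v]. *)
Definition homog n p u v := \sum_(j < n.+1) p`_j * u ^+ j * v ^+ (n - j).

Lemma homog_affine n p u v : v != 0 -> (size p <= n.+1)%N ->
  homog n p u v = v ^+ n * p.[u / v].
Proof.
move=> v0 sp; rewrite (horner_coef_wide _ sp) big_distrr; apply: eq_bigr => j _ /=.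
have jn : (j <= n)%N by rewrite -ltnS.
have -> : v ^+ n = v ^+ j * v ^+ (n - j) by rewrite -exprD subnKC.
by rewrite expr_div_n; field; rewrite expf_neq0.
Qed.

Lemma homog_infty n p u : homog n p u 0 = p`_n * u ^+ n.
Proof.
rewrite /homog big_ord_recr /= subnn expr0 mulr1 big1 ?add0r // => j _.
by rewrite expr0n subn_eq0 leqNgt ltn_ord mulr0.
Qed.

(** At the point at infinity the forms reduce to their coefficients of top
    degree, which are multiplicative; elsewhere they are multiples of values of
    polynomials. *)
Lemma homogM m n p q u v : (size p <= m.+1)%N -> (size q <= n.+1)%N ->
  homog (m + n) (p * q) u v = homog m p u v * homog n q u v.
Proof.
move=> sp sq; have spq : (size (p * q)%R <= (m + n).+1)%N.
  apply: leq_trans (size_polyMleq _ _) _.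
  by have := leq_add sp sq; rewrite addSn addnS; case: (size p + size q)%N.
have [->|v0] := eqVneq v 0; last by rewrite !homog_affine // hornerM exprD; ring.
rewrite !homog_infty exprD; suff -> : (p * q)`_(m + n) = p`_m * q`_n by ring.
rewrite coefM (bigD1 (inord m)) //= inordK ?ltnS ?leq_addr // addKn.
rewrite big1 ?addr0 // => i; rewrite -val_eqE /= inordK ?ltnS ?leq_addr // => im.
have [lt|gt] := ltnP i m; last first.
  by rewrite [p`_i]nth_default ?mul0r // (leq_trans sp) // ltn_neqAle eq_sym im.
by rewrite [q`_(_ - _)]nth_default ?mulr0 // (leq_trans sq) // ltn_subRL ltn_add2r.
Qed.

Lemma homog_sum (I : Type) (r : seq I) n (p : I -> {poly K}) u v :
  homog n (\sum_(i <- r) p i) u v = \sum_(i <- r) homog n (p i) u v.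
Proof.
rewrite /homog exchange_big /=; apply: eq_bigr => j _.
by rewrite coef_sum !big_distrl.
Qed.

Lemma homogC n (e : K) u v : homog n e%:P u v = e * v ^+ n.
Proof.
rewrite /homog big_ord_recl /= coefC eqxx expr0 mulr1 subn0 big1 ?addr0 // => j _.
by rewrite coefC /= !mul0r.
Qed.

(** Homogenization with respect to the inner variable [y] only. *)
Definition col_homog n G u v : {poly K} := \poly_(i < size G) homog n G`_i u v.

Lemma coef_col_homog n G u v i : (col_homog n G u v)`_i = homog n G`_i u v.
Proof.
rewrite coef_poly; case: ltnP => // Gi; rewrite nth_default // /homog big1 // => j _.
by rewrite coef0 !mul0r.
Qed.

Lemma col_homogM m n G H u v : (forall i, size (G`_i)%R <= m.+1)%N ->
  (forall i, size (H`_i)%R <= n.+1)%N ->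
  col_homog (m + n) (G * H) u v = col_homog m G u v * col_homog n H u v.
Proof.
move=> sG sH; apply/polyP=> i; rewrite coef_col_homog !coefM homog_sum.
by apply: eq_bigr => j _; rewrite homogM // !coef_col_homog.
Qed.

Definition form_mx m n G : 'M[K]_(m.+1, n.+1) := \matrix_(i, j) G`_i`_j.

Lemma form_mxE m n G (q : P1xP1_coord K) : bihom_eval (form_mx m n G) q =
  homog m (col_homog n G q.2.1 q.2.2) q.1.1 q.1.2.
Proof.
apply: eq_bigr => i _; rewrite coef_col_homog !big_distrl /=.
by apply: eq_bigr => j _; rewrite mxE; ring.
Qed.

Lemma form_mx1 m n (q : P1xP1_coord K) :
  bihom_eval (form_mx m n 1) q = q.1.2 ^+ m * q.2.2 ^+ n.
Proof.
rewrite form_mxE; have -> : col_homog n 1 q.2.1 q.2.2 = (q.2.2 ^+ n)%:P.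
  apply/polyP=> i; rewrite coef_col_homog coef1 coefC.
  by case: ifP => _ /=; rewrite -?polyC1 -?polyC0 homogC ?mul1r ?mul0r.
by rewrite homogC mulrC.
Qed.

Lemma form_mxM m n m' n' G H (q : P1xP1_coord K) :
  (size G <= m.+1)%N -> (forall i, size (G`_i)%R <= n.+1)%N ->
  (size H <= m'.+1)%N -> (forall i, size (H`_i)%R <= n'.+1)%N ->
  bihom_eval (form_mx (m + m') (n + n') (G * H)) q =
  bihom_eval (form_mx m n G) q * bihom_eval (form_mx m' n' H) q.
Proof.
move=> sG sG' sH sH'; rewrite !form_mxE col_homogM // homogM //.
  exact: leq_trans (size_poly _ _) sG.
exact: leq_trans (size_poly _ _) sH.
Qed.

Lemma form_mx_exists m n (g : 'M[K]_(m.+1, n.+1)) :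
  exists G, [/\ g = form_mx m n G, (size G <= m.+1)%N & forall i, (size (G`_i)%R <= n.+1)%N].
Proof.
exists (\poly_(i < m.+1) \poly_(j < n.+1) g (inord i) (inord j)); split.
- by apply/matrixP=> i j; rewrite mxE !coef_poly !ltn_ord coef_poly ltn_ord !inord_val.
- exact: size_poly.
- by move=> i; rewrite coef_poly; case: ifP => _; rewrite ?size_poly // size_poly0.
Qed.

End Homogenization.

Section FormsInField.
Variables (k : numClosedFieldType) (F : fieldType) (iota : {rmorphism k -> F}).

Lemma map_form_mx m n (G : {poly {poly k}}) :
  map_mx iota (form_mx m n G) = form_mx m n (map_poly (map_poly iota) G).
Proof. by apply/matrixP=> i j; rewrite !mxE !coef_map. Qed.

Lemma form_mx_map m n (G : {poly {poly k}}) (x0 x1 y0 y1 : F) :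
  x1 != 0 -> y1 != 0 -> (size G <= m.+1)%N -> (forall i, size (G`_i)%R <= n.+1)%N ->
  bihom_eval (map_mx iota (form_mx m n G)) ((x0, x1), (y0, y1)) =
  x1 ^+ m * y1 ^+ n * curve_eval iota (y0 / y1) (x0 / x1) G.
Proof.
move=> x10 y10 sG sG'.
rewrite map_form_mx form_mxE /= homog_affine //; last first.
  by rewrite (leq_trans (size_poly _ _)) // (leq_trans (size_poly _ _)).
rewrite -mulrA; congr (_ * _).
rewrite /curve_eval /= /horner_eval -hornerZ; congr (_.[_]); apply/polyP=> i.
rewrite coef_col_homog coefZ !coef_map /= homog_affine //.
by rewrite (leq_trans (size_poly _ _)).
Qed.

End FormsInField.

(** * Function fields of the curve *)

Section FunctionField.
Variable k : numClosedFieldType.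
Variables (a b c : {poly k}).
Local Notation K := (xquad a b c).
Hypotheses (c0 : c != 0) (irrK : ~ reducible K).
Hypotheses (sa : (size a <= 3)%N) (sb : (size b <= 3)%N) (sc : (size c <= 3)%N).
Hypothesis degY : sizeY K = 3%N.

Variable V : set (P1xP1_coord k).
Hypothesis VE : forall q, V q <-> in_P1xP1 q /\ bihom_eval (form_mx 2 2 K) q = 0.

Let sizeK : size K = 3%N. Proof. exact: size_xquad. Qed.
Let sizeKi i : (size (K`_i)%R <= 3)%N.
Proof. exact: size_coef_xquad. Qed.

Lemma xdisc_neq0 : xdisc a b c != 0.
Proof.
apply/eqP => D0; have c20 : 2 * c != 0 by rewrite mulf_neq0 // -polyC_natr polyC_eq0 pnatr_eq0.
have := irreducible_no_root (- b) irrK c0 c20; apply/negP; rewrite negbK; apply/eqP.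
have -> : c * (- b) ^+ 2 + b * - b * (2 * c) + a * (2 * c) ^+ 2 = - (c * xdisc a b c).
  by rewrite /xdisc; ring.
by rewrite D0 mulr0 oppr0.
Qed.

(** Pseudo-division by [K], whose leading coefficient in [x] is [c]. *)
Lemma division (G : {poly {poly k}}) : exists n Q r0 r1,
  (c ^+ n)%:P * G = Q * K + (r0%:P + r1%:P * 'X).
Proof.
exists (scalp G K), (G %/ K), (G %% K)`_0, (G %% K)`_1.
have K0 : K != 0 by rewrite -size_poly_eq0 sizeK.
have := Pdiv.Idomain.divp_eq G K.
have -> : lead_coef K = c by rewrite lead_coefE sizeK coef_xquad.
rewrite -mul_polyC => ->; congr (_ + _); apply/polyP=> i.
have sR : (size (G %% K)%R <= 2)%N by have := Pdiv.Idomain.ltn_modpN0 G K0; rewrite sizeK ltnS.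
rewrite coefD coefC coefCM coefX; case: i => [|[|i]] /=.
- by rewrite mulr0 addr0.
- by rewrite mulr1 add0r.
- by rewrite mulr0 addr0 nth_default // (leq_trans sR).
Qed.

Lemma affine_point (x y : k) : V ((x, 1), (y, 1)) <->
  c.[y] * x ^+ 2 + b.[y] * x + a.[y] = 0.
Proof.
have onz (z : k) : (z, 1 : k) <> (0, 0) by case=> _ /eqP; rewrite oner_eq0.
apply: (iff_trans (VE _)); rewrite /in_P1xP1 form_mxE /= !homog_affine ?oner_neq0 //; last first.
  by rewrite -sizeK size_poly.
rewrite !divr1 !expr1n !mul1r (@horner_coef_wide _ 3 (col_homog 2 K y 1)); last first.
  by rewrite -sizeK size_poly.
rewrite !big_ord_recr big_ord0 /= !coef_col_homog !homog_affine ?oner_neq0 //.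
rewrite !coef_xquad /= !divr1 !expr1n !mul1r add0r expr0 mulr1 expr1.
have -> : a.[y] + b.[y] * x + c.[y] * x ^+ 2 = c.[y] * x ^+ 2 + b.[y] * x + a.[y] by ring.
by split=> [[]//|].
Qed.

Section KernelFieldIsFunctionField.
Variables (F : fieldType) (iota : {rmorphism k -> F}) (x y : F).
Hypothesis kf : kernel_field iota a b c x y.
Local Notation curve_eval := (curve_eval iota y x).

Let ty : transcendental iota y. Proof. by case: kf. Qed.
Let xN : ~ rational_in iota y x. Proof. by case: kf. Qed.

Lemma curve_eval_kernel : curve_eval K = 0.
Proof.
have [_ _ _ rel] := kf; rewrite -rel /xquad.
rewrite !(rmorphD, rmorphXn, rmorphM) /= !curve_evalC !curve_evalX.
by ring.
Qed.

Lemma curve_eval_linear r0 r1 : curve_eval (r0%:P + r1%:P * 'X) = 0 -> r0 = 0 /\ r1 = 0.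
Proof.
rewrite rmorphD rmorphM /= !curve_evalC curve_evalX.
by case/(rational_free xN); [exact: rational_in_peval..|move=> /ty-> /ty->].
Qed.

(** If [G] vanishes at the generic point, then [c^n G = Q K] for some [n]; by gauss
    and the irreducibility of [K], the factor [c^n] divides [Q]. *)
Lemma curve_eval_eq0 G : curve_eval G = 0 -> exists H, G = H * K.
Proof.
move=> G0; have [n [Q [r0 [r1 E]]]] := division G.
have [r00 r10] : r0 = 0 /\ r1 = 0.
  apply: curve_eval_linear; have := congr1 curve_eval E.
  by rewrite rmorphD !rmorphM /= G0 curve_eval_kernel !mulr0 add0r.
have cn0 : c ^+ n != 0 by rewrite expf_neq0.
have [|c1 [c2 [Q1 [K1 [c10 c20 EQ EK EG]]]]] := gauss cn0 (P := G) (U := Q) (V := K).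
  by rewrite E r00 r10 polyC0 mul0r !addr0.
have sK1 : size K1 = 3%N by rewrite -sizeK EK mul_polyC size_scale.
have /size_poly1P[e e0 Ee] : size c2 == 1%N.
  apply/negPn/negP => sc2; apply: irrK; exists c2%:P, K1; split=> //.
    by rewrite poly_unitE coefC eqxx poly_unitE (negPf sc2) !andbF.
  by apply: nonunit_size; rewrite sK1.
have eK : (e^-1)%:P%:P * e%:P%:P = 1 :> {poly {poly k}} by rewrite -!rmorphM mulVf.
by exists ((e^-1)%:P%:P * Q1); rewrite EG EK Ee mulrACA eK mul1r.
Qed.

(** Modulo [K], replace [G] by [r0 + r1 x].  Over a value [be] of [y] for which
    [c] and the discriminant are nonzero there are two points of the curve, and
    [r0 + r1 x] vanishes at both of them, so that [r0] and [r1] vanish at [be].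
    This holds for all [be] but finitely many. *)
Lemma vanish_curve_eval (G : {poly {poly k}}) m n : (size G <= m.+1)%N ->
  (forall i, (size (G`_i)%R <= n.+1)%N) ->
  (forall q, V q -> bihom_eval (form_mx m n G) q = 0) -> curve_eval G = 0.
Proof.
move=> sG sG' G0; have [e [Q [r0 [r1 E]]]] := division G.
have evG al be : c.[be] * al ^+ 2 + b.[be] * al + a.[be] = 0 -> r0.[be] + r1.[be] * al = 0.
  move=> Kab; have /G0 := (affine_point al be).2 Kab.
  rewrite form_mxE /= !homog_affine ?oner_neq0 //; last first.
    exact: leq_trans (size_poly _ _) sG.
  rewrite expr1n mul1r divr1 => Gab.
  have Gpe : place_eval be al G = 0.
    rewrite -[LHS]/((map_poly (horner_eval be) G).[al]) -{}Gab; congr (_.[_]).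
    apply/polyP=> i; rewrite coef_map coef_col_homog homog_affine ?oner_neq0 //=.
    by rewrite expr1n mul1r divr1.
  have := congr1 (place_eval be al) E; rewrite /xquad.
  rewrite !(rmorphD, rmorphXn, rmorphM) /= !place_evalC !place_evalX Gpe mulr0.
  have -> : a.[be] + b.[be] * al + c.[be] * al ^+ 2 = 0 by rewrite -Kab; ring.
  by rewrite mulr0 add0r => <-.
have r_be be : (c * xdisc a b c).[be] != 0 -> r0.[be] = 0 /\ r1.[be] = 0.
  rewrite hornerM mulf_eq0 negb_or => /andP[cb Db].
  pose s := sqrtC (xdisc a b c).[be].
  have s2 : s ^+ 2 = b.[be] ^+ 2 - 4 * a.[be] * c.[be].
    by rewrite sqrtCK /xdisc !hornerE /=; ring.
  have s0 : s != 0 by rewrite sqrtC_eq0.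
  have two0 : 2 != 0 :> k by rewrite pnatr_eq0.
  have Ea : a.[be] = (b.[be] ^+ 2 - s ^+ 2) / (4 * c.[be]).
    by rewrite s2; field.
  have R1 : r0.[be] + r1.[be] * ((- b.[be] + s) / (2 * c.[be])) = 0.
    by apply: evG; rewrite Ea; field.
  have R2 : r0.[be] + r1.[be] * ((- b.[be] - s) / (2 * c.[be])) = 0.
    by apply: evG; rewrite Ea; field.
  have r10 : r1.[be] = 0.
    apply: (mulIf s0); rewrite mul0r.
    have -> : r1.[be] * s = c.[be] *
      ((r0.[be] + r1.[be] * ((- b.[be] + s) / (2 * c.[be]))) -
       (r0.[be] + r1.[be] * ((- b.[be] - s) / (2 * c.[be])))) by field.
    by rewrite R1 R2 subrr mulr0.
  by split=> //; move: R1; rewrite r10 mul0r addr0.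
have poly0 (r : {poly k}) : (forall be, (c * xdisc a b c).[be] != 0 -> r.[be] = 0) -> r = 0.
  move=> r0'; apply/eqP/negPn/negP => rN0.
  have : r * (c * xdisc a b c) != 0 by rewrite !mulf_neq0 // xdisc_neq0.
  move/closed_nonrootP => [be]; rewrite rootM negb_or => /andP[rb Db].
  by move: rb; rewrite rootE r0' ?eqxx.
have r00 : r0 = 0 by apply: poly0 => be /r_be[].
have r10 : r1 = 0 by apply: poly0 => be /r_be[].
have := congr1 curve_eval E.
rewrite r00 r10 rmorphD !rmorphM /= curve_eval_kernel curve_evalC polyC0 mul0r addr0.
rewrite rmorph0 mulr0 addr0.
by move/eqP; rewrite mulf_eq0 (negPf (transcendental_neq0 ty _)) ?expf_neq0 // => /eqP.
Qed.

(** A multiple of [K] vanishes at the affine points of the curve; the bounds on the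
    degrees of the cofactor make it vanish also at infinity, since
    homogenization is multiplicative. *)
Lemma curve_eval_vanish (G : {poly {poly k}}) m n : (size G <= m.+1)%N ->
  (forall i, (size (G`_i)%R <= n.+1)%N) ->
  curve_eval G = 0 -> forall q, V q -> bihom_eval (form_mx m n G) q = 0.
Proof.
move=> sG sG' /curve_eval_eq0[H EG] q /VE[_ Kq].
have [G0|GN0] := eqVneq G 0.
  by apply: big1 => i _; apply: big1 => j _; rewrite mxE G0 !coef0 !mul0r.
have HN0 : H != 0 by apply: contraNneq GN0 => H0; rewrite EG H0 mul0r.
have KN0 : K != 0 by rewrite -size_poly_eq0 sizeK.
have sH : (size H + 2 <= m.+1)%N.
  by move: sG; rewrite EG size_mul // sizeK !addnS.
have sYH : (sizeY H + 2 <= n.+1)%N.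
  have : (sizeY G <= n.+1)%N by apply/bigmax_leqP => i _; apply: sG'.
  rewrite EG !sizeYE rmorphM size_mul ?swapXY_eq0 // -!sizeYE degY !addnS.
  done.
have sYHi i : (size (H`_i)%R <= sizeY H)%N.
  rewrite /sizeY; case: (ltnP i (size H)) => [ltiH|leHi].
    exact: (@leq_bigmax _ (fun i : 'I_(size H) => size H`_i) (Ordinal ltiH)).
  by rewrite nth_default // size_poly0.
have m2 : m = (m - 2 + 2)%N.
  by rewrite subnK // -ltnS (leq_trans _ sH) // addn2 !ltnS size_poly_gt0.
have n2 : n = (n - 2 + 2)%N.
  by rewrite subnK // -ltnS (leq_trans _ sYH) // addn2 !ltnS sizeYE size_poly_gt0 swapXY_eq0.
rewrite m2 n2 EG form_mxM ?Kq ?mulr0 //.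
- by rewrite -(leq_add2r 2) addSn -m2.
- move=> i; rewrite (leq_trans (sYHi i)) //.
  by rewrite -(leq_add2r 2) addSn -n2.
- by rewrite sizeK.
Qed.

Lemma kernel_field_function_field : is_function_field iota V.
Proof.
exists ((x, 1), (y, 1)); split.
- by split=> /=; case=> _ /eqP; rewrite oner_eq0.
- move=> m n g; have [G [-> sG sG']] := form_mx_exists g.
  rewrite form_mx_map ?oner_neq0 // !expr1n !mul1r !divr1.
  by split; [apply: curve_eval_vanish | apply: vanish_curve_eval].
- have [_ _ gen _] := kf.
  suff PF f : exists G H, curve_eval H != 0 /\ f = curve_eval G / curve_eval H.
    move=> f; have [G [H [H0 Ef]]] := PF f.
    pose m := maxn (size G) (size H); pose n := maxn (sizeY G) (sizeY H).
    have szY (P : {poly {poly k}}) i : (size (P`_i)%R <= sizeY P)%N.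
      rewrite /sizeY; case: (ltnP i (size P)) => [ltiP|lePi].
        exact: (@leq_bigmax _ (fun i : 'I_(size P) => size P`_i) (Ordinal ltiP)).
      by rewrite nth_default // size_poly0.
    exists m, n, (form_mx m n G), (form_mx m n H).
    rewrite !form_mx_map ?oner_neq0 //; last 1 [idtac].
    all: try by rewrite /m leqW ?leq_maxl ?leq_maxr.
    all: try by move=> i; rewrite (leq_trans (szY _ _)) // leqW // /n ?leq_maxl ?leq_maxr.
    by rewrite !expr1n !mul1r !divr1; split; [apply/eqP|].
  move: f; apply: gen; first split.
  + by move=> e; exists e%:P%:P, 1; rewrite rmorph1 oner_neq0 curve_evalC pevalC divr1.
  + move=> _ _ [G [H [H0 ->]]] [G' [H' [H'0 ->]]].
    exists (G * H' + G' * H), (H * H'); rewrite !(rmorphD, rmorphM) /= mulf_neq0 //.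
    split=> //; move: (curve_eval H) (curve_eval H') H0 H'0 => h h' h0 h'0.
    by field; rewrite h0 h'0.
  + move=> _ _ [G [H [H0 ->]]] [G' [H' [H'0 ->]]].
    exists (G * G'), (H * H'); rewrite !rmorphM /= mulf_neq0 //.
    by rewrite mulf_div.
  + move=> _ [G [H [H0 ->]]]; have [G0|G0] := eqVneq (curve_eval G) 0.
      by exists 0, 1; rewrite G0 !mul0r invr0 rmorph0 rmorph1 oner_neq0 mul0r.
    by exists H, G; rewrite invf_div.
  + by exists 'X, 1; rewrite rmorph1 oner_neq0 curve_evalX divr1.
  + by exists 'X%:P, 1; rewrite rmorph1 oner_neq0 curve_evalC pevalX divr1.
Qed.

End KernelFieldIsFunctionField.

End FunctionField.

(** Every fibre of the two projections of the curve has a point. *)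
Lemma homog2_zero (k : closedFieldType) (p : {poly k}) : (size p <= 3)%N ->
  exists u v : k, (u, v) <> (0, 0) /\ homog 2 p u v = 0.
Proof.
move=> sp; have [p2|p2] := eqVneq p`_2 0.
  exists 1, 0; split; first by case=> /eqP; rewrite oner_eq0.
  by rewrite homog_infty p2 mul0r.
have [|r /rootP pr] := closed_rootP p _.
  by apply: contraNneq p2 => sp1; rewrite nth_default // sp1.
exists r, 1; split; first by case=> _ /eqP; rewrite oner_eq0.
by rewrite homog_affine ?oner_neq0 // divr1 pr mulr0.
Qed.

Section GenericPoint.
Variable k : numClosedFieldType.
Variables (a b c : {poly k}).
Local Notation K := (xquad a b c).
Hypotheses (c0 : c != 0) (irrK : ~ reducible K).
Hypotheses (sa : (size a <= 3)%N) (sb : (size b <= 3)%N) (sc : (size c <= 3)%N).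

Variable V : set (P1xP1_coord k).
Hypothesis VE : forall q, V q <-> in_P1xP1 q /\ bihom_eval (form_mx 2 2 K) q = 0.

Let sizeKi i : (size (K`_i)%R <= 3)%N.
Proof. exact: size_coef_xquad. Qed.

Lemma point_over_y (y0 y1 : k) : (y0, y1) <> (0, 0) ->
  exists x0 x1, V ((x0, x1), (y0, y1)).
Proof.
move=> y01; have [|x0 [x1 [x01 E]]] := @homog2_zero _ (col_homog 2 K y0 y1).
  by rewrite (leq_trans (size_poly _ _)) // size_xquad.
by exists x0, x1; apply/VE; split=> //; rewrite form_mxE.
Qed.

Lemma point_over_x (x0 x1 : k) : (x0, x1) <> (0, 0) ->
  exists y0 y1, V ((x0, x1), (y0, y1)).
Proof.
move=> x01; pose p := \sum_(i < 3) (x0 ^+ i * x1 ^+ (2 - i)) *: K`_i.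
have [|y0 [y1 [y01 E]]] := @homog2_zero _ p.
  apply: (leq_trans (size_sum _ _ _)); apply/bigmax_leqP => i _.
  by rewrite (leq_trans (size_scale_leq _ _)).
exists y0, y1; apply/VE; split=> //; rewrite form_mxE -E /p homog_sum.
apply: eq_bigr => i _; rewrite coef_col_homog /homog !big_distrl /=.
by apply: eq_bigr => j _; rewrite coefZ; ring.
Qed.

(** The forms [x1], [y1] and the nonzero polynomials in [y] do not vanish on the
    whole curve, because both projections to the line are surjective; so they do
    not vanish at the generic point, which has affine coordinates [x] and [y] with
    [y] transcendental. *)
Lemma generic_kernel_field (F : fieldType) (iota : {rmorphism k -> F}) :
  is_function_field iota V -> exists x y, kernel_field iota a b c x y.
Proof.
move=> [[[x0 x1] [y0 y1]] [_ vanish gen]].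
have form0 m n (G : {poly {poly k}}) :
    (forall q, V q -> bihom_eval (form_mx m n G) q = 0) ->
    bihom_eval (map_mx iota (form_mx m n G)) ((x0, x1), (y0, y1)) = 0.
  by move/vanish.
have x10 : x1 != 0.
  apply/eqP => x10; have [y0' [y1' Vq]] : exists y0 y1, V ((1, 1), (y0, y1)).
    by apply: point_over_x; case=> /eqP; rewrite oner_eq0.
  have : bihom_eval (map_mx iota (form_mx 1 0 1)) ((x0, x1), (y0, y1)) = 0.
    by rewrite map_form_mx rmorph1 form_mx1 /= x10 expr1 mul0r.
  by move/vanish/(_ _ Vq); rewrite form_mx1 /= expr1n mul1r => /eqP; rewrite oner_eq0.
have y10 : y1 != 0.
  apply/eqP => y10; have [x0' [x1' Vq]] : exists x0 x1, V ((x0, x1), (1, 1)).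
    by apply: point_over_y; case=> /eqP; rewrite oner_eq0.
  have : bihom_eval (map_mx iota (form_mx 0 1 1)) ((x0, x1), (y0, y1)) = 0.
    by rewrite map_form_mx rmorph1 form_mx1 /= y10 expr1 mulr0.
  by move/vanish/(_ _ Vq); rewrite form_mx1 /= expr1n mulr1 => /eqP; rewrite oner_eq0.
exists (x0 / x1), (y0 / y1).
have ty : transcendental iota (y0 / y1).
  move=> p py; have p_root be : p.[be] = 0.
    have [x0' [x1' Vq]] : exists x0 x1, V ((x0, x1), (be, 1)).
      by apply: point_over_y; case=> _ /eqP; rewrite oner_eq0.
    have sC i : (size ((p%:P : {poly {poly k}})`_i)%R <= (size p).+1)%N.
      by rewrite coefC; case: ifP; rewrite ?size_poly0.
    have : bihom_eval (map_mx iota (form_mx 0 (size p) p%:P)) ((x0, x1), (y0, y1)) = 0.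
      by rewrite form_mx_map // ?size_polyC_leq1 // curve_evalC py mulr0.
    move/vanish/(_ _ Vq); rewrite form_mxE /homog big_ord_recl big_ord0 /=.
    rewrite coef_col_homog homog_affine ?oner_neq0 // coefC /= divr1 expr1n mul1r.
    by rewrite expr0 !mulr1 addr0.
  apply/eqP/negPn/negP => /closed_nonrootP[be].
  by rewrite rootE p_root eqxx.
have rel : peval iota (y0 / y1) c * (x0 / x1) ^+ 2 + peval iota (y0 / y1) b * (x0 / x1) +
    peval iota (y0 / y1) a = 0.
  have /eqP : bihom_eval (map_mx iota (form_mx 2 2 K)) ((x0, x1), (y0, y1)) = 0.
    by apply: form0 => q /VE[].
  have d0 : x1 ^+ 2 * y1 ^+ 2 != 0 by rewrite mulf_neq0 // expf_neq0.
  rewrite form_mx_map ?size_xquad // mulf_eq0 (negPf d0) /=.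
  rewrite /xquad !(rmorphD, rmorphXn, rmorphM) /= !curve_evalC !curve_evalX => /eqP <-.
  by ring.
split=> //.
- move=> [p [q [q0 Ex]]].
  have qN0 : q != 0 by apply: contraNneq q0 => ->; rewrite rmorph0.
  have := irreducible_no_root p irrK c0 qN0; apply/negP; rewrite negbK.
  apply/eqP/ty; move: rel; rewrite Ex !(rmorphD, rmorphXn, rmorphM) /=.
  move: (peval _ _ q) q0 => e e0 rel.
  by rewrite -(mul0r (e ^+ 2)) -rel; field.
- move=> P sP Px Py f; have [_ _ PM PV] := sP.
  have Pform m n (g : 'M[k]_(m.+1, n.+1)) :
      P (bihom_eval (map_mx iota g) ((x0, x1), (y0, y1)) / (x1 ^+ m * y1 ^+ n)).
    have [G [-> sG sG']] := form_mx_exists g.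
    rewrite form_mx_map // mulrAC divff ?mul1r; last first.
      by rewrite mulf_neq0 // expf_neq0.
    rewrite /curve_eval /= /horner_eval horner_coef; apply: (subfield_sum _ sP) => i.
    apply: (PM); last exact: (subfieldX _ sP Px).
    by rewrite coef_map; apply: (subfield_peval _ sP Py).
  have [m [n [g [h [/eqP h0 ->]]]]] := gen f.
  have d0 : x1 ^+ m * y1 ^+ n != 0 by rewrite mulf_neq0 // expf_neq0.
  have -> : bihom_eval (map_mx iota g) ((x0, x1), (y0, y1)) /
      bihom_eval (map_mx iota h) ((x0, x1), (y0, y1)) =
      (bihom_eval (map_mx iota g) ((x0, x1), (y0, y1)) / (x1 ^+ m * y1 ^+ n)) *
      (bihom_eval (map_mx iota h) ((x0, x1), (y0, y1)) / (x1 ^+ m * y1 ^+ n))^-1.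
    by rewrite invf_div mulrA divfK.
  by apply: (PM); [exact: Pform | apply/PV/Pform].
Qed.

End GenericPoint.

(** The basis of the regular differentials in genus one would be zero in
    genus zero. *)
Lemma genus01_absurd (k F : fieldType) (iota : {rmorphism k -> F}) :
  field_genus iota 0 -> field_genus iota 1 -> False.
Proof.
move=> [w [_ _ spanned]] [w1 [reg free _]].
have [e we] := spanned _ (reg ord0).
have := free (fun _ => 1) _ ord0 => H.
have : (1 : k) = 0.
  by apply: H => D; rewrite big_ord1 we big_ord0 mulr0.
by move/eqP; rewrite oner_eq0.
Qed.

Section Inversions.
Variables (k F : fieldType) (iota : {rmorphism k -> F}) (x y : F).

Lemma generated_byVl : generated_by iota x y -> generated_by iota x^-1 y.
Proof.
by move=> gen P sP Px Py; apply: gen => //; have [_ _ _ PV] := sP; rewrite -(invrK x); apply: PV.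
Qed.

Lemma generated_byVr : generated_by iota x y -> generated_by iota x y^-1.
Proof.
by move=> gen P sP Px Py; apply: gen => //; have [_ _ _ PV] := sP; rewrite -(invrK y); apply: PV.
Qed.

Lemma not_rational_inVl : ~ rational_in iota y x -> ~ rational_in iota y x^-1.
Proof.
move=> xN r; apply: xN; have [_ _ _ PV] := rational_in_subfield iota y.
by rewrite -(invrK x); apply: PV.
Qed.

Lemma not_rational_inVr : ~ rational_in iota y x -> ~ rational_in iota y^-1 x.
Proof. by move=> xN /rational_inVE. Qed.

End Inversions.

(** * Models of walks *)

Section Model.
Variables (R : realType) (d : int -> int -> R) (t : R).
Hypothesis d_itv : forall i j : int,
     i \in step_range -> j \in step_range -> 0 <= d i j <= 1.
Hypothesis d_sum : \sum_(i <- step_range) \sum_(j <- step_range) d i j = 1.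
Hypothesis t_itv : 0 < t < 1.

Local Notation C := R[i].
Local Notation toC := (real_complex R).

Definition weight_row i : {poly R} := quad (t * d i (-1)) (t * d i 0) (t * d i 1).

Definition kernel_a : {poly C} := - map_poly toC (weight_row (-1)).
Definition kernel_b : {poly C} := 'X - map_poly toC (weight_row 0).
Definition kernel_c : {poly C} := - map_poly toC (weight_row 1).
Local Notation K := (xquad kernel_a kernel_b kernel_c).

Definition real_disc := quad_disc (weight_row (-1)) (weight_row 0) (weight_row 1).

Lemma map_weight_row i : map_poly toC (weight_row i) =
  (toC (t * d i (-1)))%:P + (toC (t * d i 0)) *: 'X + (toC (t * d i 1)) *: 'X^2.
Proof.
by rewrite /weight_row /quad !rmorphD /= map_polyC !map_polyZ map_polyX map_polyXn.
Qed.

Lemma coef_map_weight_row i j : (map_poly toC (weight_row i))`_j =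
    if j == 0%N then toC (t * d i (-1)) else if j == 1%N then toC (t * d i 0)
    else if j == 2%N then toC (t * d i 1) else 0.
Proof.
rewrite map_weight_row !coefD !coefZ coefC coefX coefXn.
by case: j => [|[|[|j]]] /=; rewrite ?(mulr0, mulr1, addr0, add0r).
Qed.

Lemma kernel_polyE : kernel_poly d t = K.
Proof.
rewrite /kernel_poly /xquad /kernel_a /kernel_b /kernel_c !map_weight_row.
rewrite !big_ord_recl !big_ord0 /= /bump /=.
have -> : (0%N%:Z - 1 = -1 :> int) by [].
have -> : (1%N%:Z - 1 = 0 :> int) by [].
have -> : (2%N%:Z - 1 = 1 :> int) by [].
rewrite -!mul_polyC !(rmorphM toC) !(polyCN, polyCB, polyCD, polyCM, polyC_exp).
move: ('X : {poly {poly C}}) ('Y : {poly {poly C}}) (_ t)%:P%:P (_ (d (-1) (-1)))%:P%:P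
  (_ (d (-1) 0))%:P%:P (_ (d (-1) 1))%:P%:P (_ (d 0 (-1)))%:P%:P (_ (d 0 0))%:P%:P
  (_ (d 0 1))%:P%:P (_ (d 1 (-1)))%:P%:P (_ (d 1 0))%:P%:P (_ (d 1 1))%:P%:P.
by move=> *; ring.
Qed.

Lemma kernel_formE x0 x1 y0 y1 : kernel_form d t x0 x1 y0 y1 =
  bihom_eval (form_mx 2 2 K) ((x0, x1), (y0, y1)).
Proof.
rewrite /kernel_form /bihom_eval !big_ord_recl !big_ord0 /= /bump /=.
have -> : (0%N%:Z - 1 = -1 :> int) by [].
have -> : (1%N%:Z - 1 = 0 :> int) by [].
have -> : (2%N%:Z - 1 = 1 :> int) by [].
rewrite !mxE !coef_xquad /= /kernel_a /kernel_b /kernel_c !coefD !coefN !coefX.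
rewrite !coef_map_weight_row !rmorphM /=.
by ring.
Qed.

Lemma kernel_curveE q : kernel_curve d t q <->
  in_P1xP1 q /\ bihom_eval (form_mx 2 2 K) q = 0.
Proof. by case: q => [[x0 x1] [y0 y1]]; rewrite /kernel_curve /= kernel_formE. Qed.

Lemma xdisc_kernel : xdisc kernel_a kernel_b kernel_c = map_poly toC real_disc.
Proof.
rewrite /xdisc /real_disc /quad_disc !(rmorphB, rmorphXn, rmorphM) /= map_polyX rmorph_nat.
by rewrite /kernel_a /kernel_b /kernel_c; ring.
Qed.

Let t0 : 0 < t. Proof. by case/andP: t_itv. Qed.

Let w_ge0 i j : i \in step_range -> j \in step_range -> 0 <= t * d i j.
Proof. by move=> ir jr; rewrite mulr_ge0 ?(ltW t0) //; case/andP: (d_itv ir jr). Qed.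

Let w_eq0 i j : t * d i j = 0 -> d i j = 0.
Proof. by move/eqP; rewrite mulf_eq0 (gt_eqF t0) => /eqP. Qed.

Lemma half_plane_of_normal (a b : int) : (a, b) != (0, 0) ->
  (forall i j, i \in step_range -> j \in step_range -> d i j != 0 -> 0 <= a * i + b * j) ->
  in_half_plane R (step_set d).
Proof.
move=> ab H; exists a%:~R, b%:~R; split.
  apply: contra_neq_not ab; case=> /eqP; rewrite intr_eq0 => /eqP-> /eqP.
  by rewrite intr_eq0 => /eqP->.
by move=> i j [/= ir jr dij]; rewrite -!intrM -intrD ler0z H.
Qed.

(** The complement of each side of the square, and of each corner together with its
    two neighbours, is a set of steps contained in a half plane. *)
Definition boundary_steps :=
  [/\ ~ [/\ d (-1) (-1) = 0, d (-1) 0 = 0 & d (-1) 1 = 0],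
      ~ [/\ d 1 (-1) = 0, d 1 0 = 0 & d 1 1 = 0],
      ~ [/\ d (-1) (-1) = 0, d 0 (-1) = 0 & d 1 (-1) = 0]
    & ~ [/\ d (-1) 1 = 0, d 0 1 = 0 & d 1 1 = 0]].

Definition corner_steps :=
  [/\ ~ [/\ d (-1) (-1) = 0, d (-1) 0 = 0 & d 0 (-1) = 0],
      ~ [/\ d 1 (-1) = 0, d 1 0 = 0 & d 0 (-1) = 0],
      ~ [/\ d (-1) 1 = 0, d (-1) 0 = 0 & d 0 1 = 0]
    & ~ [/\ d 1 1 = 0, d 1 0 = 0 & d 0 1 = 0]].

Local Ltac check_steps := move=> i j; rewrite !inE => /or3P[]/eqP-> /or3P[]/eqP->;
  repeat match goal with E : d _ _ = 0 |- _ => rewrite ?E; clear E end; rewrite ?eqxx.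

Lemma not_half_plane : ~ in_half_plane R (step_set d) -> boundary_steps /\ corner_steps.
Proof.
have dir (a b : int) (P : Prop) : (a, b) != (0, 0) -> ~ in_half_plane R (step_set d) ->
    (P -> forall i j, i \in step_range -> j \in step_range -> d i j != 0 ->
      0 <= a * i + b * j) -> ~ P.
  by move=> ab hN H p; apply: hN; apply: (half_plane_of_normal ab) (H p).
move=> hN; split; split.
- by apply: (dir 1 0) => // -[E1 E2 E3]; check_steps.
- by apply: (dir (-1) 0) => // -[E1 E2 E3]; check_steps.
- by apply: (dir 0 1) => // -[E1 E2 E3]; check_steps.
- by apply: (dir 0 (-1)) => // -[E1 E2 E3]; check_steps.
- by apply: (dir 1 1) => // -[E1 E2 E3]; check_steps.
- by apply: (dir (-1) 1) => // -[E1 E2 E3]; check_steps.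
- by apply: (dir 1 (-1)) => // -[E1 E2 E3]; check_steps.
- by apply: (dir (-1) (-1)) => // -[E1 E2 E3]; check_steps.
Qed.

Let weight_sum : t * d (-1) (-1) + t * d (-1) 0 + t * d (-1) 1 +
  (t * d 0 (-1) + t * d 0 0 + t * d 0 1) + (t * d 1 (-1) + t * d 1 0 + t * d 1 1) < 1.
Proof.
have -> : t * d (-1) (-1) + t * d (-1) 0 + t * d (-1) 1 +
  (t * d 0 (-1) + t * d 0 0 + t * d 0 1) + (t * d 1 (-1) + t * d 1 0 + t * d 1 1) =
  t * (\sum_(i <- step_range) \sum_(j <- step_range) d i j).
  by rewrite /step_range !big_cons !big_nil; ring.
by rewrite d_sum mulr1; case/andP: t_itv.
Qed.

(** The conditions on the lower triples of steps provide two roots by two_roots, and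
    the conditions on the upper triples do so after reversing the steps
    vertically, which reverses the discriminant. *)
Lemma real_disc_separable : boundary_steps -> corner_steps ->
  [/\ (1 < size real_disc)%N, separable_poly real_disc & separable_poly (revp 4 real_disc)].
Proof.
move=> [nW nE nS nN] [nSW nSE nNW nNE].
have ge i : i \in step_range -> [/\ 0 <= t * d i (-1), 0 <= t * d i 0 & 0 <= t * d i 1].
  by move=> ir; split; apply: w_ge0.
have ge' i : i \in step_range -> [/\ 0 <= t * d i 1, 0 <= t * d i 0 & 0 <= t * d i (-1)].
  by case/ge.
have roots : exists r1 r2, [/\ -1 < r1, r1 < r2, r2 < 1, root real_disc r1 & root real_disc r2].
  apply: two_roots; rewrite ?weight_sum //; try exact: ge.
  - by case=> /w_eq0 E1 /w_eq0 E2 /w_eq0 E3; apply: nW.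
  - by case=> /w_eq0 E1 /w_eq0 E2 /w_eq0 E3; apply: nE.
  - by case=> /w_eq0 E1 /w_eq0 E2 /w_eq0 E3; apply: nS.
  - by case=> /w_eq0 E1 /w_eq0 E2 /w_eq0 E3; apply: nSW.
  - by case=> /w_eq0 E1 /w_eq0 E2 /w_eq0 E3; apply: nSE.
have roots' : exists r1 r2, [/\ -1 < r1, r1 < r2, r2 < 1, root (revp 4 real_disc) r1 &
    root (revp 4 real_disc) r2].
  rewrite /real_disc quad_disc_rev; apply: two_roots; try exact: ge'.
  - apply: le_lt_trans weight_sum; rewrite le_eqVlt; apply/orP; left; apply/eqP; ring.
  - by case=> /w_eq0 E1 /w_eq0 E2 /w_eq0 E3; apply: nW.
  - by case=> /w_eq0 E1 /w_eq0 E2 /w_eq0 E3; apply: nE.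
  - by case=> /w_eq0 E1 /w_eq0 E2 /w_eq0 E3; apply: nN.
  - by case=> /w_eq0 E1 /w_eq0 E2 /w_eq0 E3; apply: nNW.
  - by case=> /w_eq0 E1 /w_eq0 E2 /w_eq0 E3; apply: nNE.
have D1 : 0 < real_disc.[1].
  by apply: quad_disc_gt0; rewrite ?weight_sum ?expr1n //; apply: ge.
have D0 : real_disc != 0 by apply: contraTneq D1 => ->; rewrite horner0 ltxx.
have sD : (size real_disc <= 5)%N by apply: size_quad_disc.
split.
- have [r1 [r2 [_ _ _ r1D _]]] := roots.
  exact: root_size_gt1 D0 r1D.
- exact: separable_quartic.
- apply: separable_quartic; rewrite ?revpK //; first exact: revp_neq0.
  exact: size_poly.
Qed.

Lemma size_map_weight_row i : (size (map_poly toC (weight_row i)) <= 3)%N.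
Proof. by rewrite size_map_poly size_quad. Qed.

Lemma size_kernel_a : (size kernel_a <= 3)%N.
Proof. by rewrite size_polyN size_map_weight_row. Qed.

Lemma size_kernel_b : (size kernel_b <= 3)%N.
Proof.
apply: leq_trans (size_polyD _ _) _; rewrite geq_max size_polyX size_polyN.
exact: size_map_weight_row.
Qed.

Lemma size_kernel_c : (size kernel_c <= 3)%N.
Proof. by rewrite size_polyN size_map_weight_row. Qed.

Lemma size_coef_kernel i : (size (K`_i)%R <= 3)%N.
Proof. exact: size_coef_xquad size_kernel_a size_kernel_b size_kernel_c. Qed.

Lemma kernel_c_eq0 : (kernel_c == 0) = [&& d 1 (-1) == 0, d 1 0 == 0 & d 1 1 == 0].
Proof.
have tN0 := gt_eqF t0; have E j : (toC (t * d 1 j) == 0) = (d 1 j == 0).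
  by rewrite fmorph_eq0 mulf_eq0 tN0.
rewrite /kernel_c oppr_eq0; apply/eqP/and3P => [/polyP r0|[/eqP e0 /eqP e1 /eqP e2]].
  have := r0 0%N; have := r0 1%N; have := r0 2%N; rewrite !coef_map_weight_row !coef0 /=.
  by move=> /eqP + /eqP + /eqP; rewrite !E.
apply/polyP=> j; rewrite coef_map_weight_row coef0 e0 e1 e2 mulr0 rmorph0.
by rewrite !if_same.
Qed.

Lemma sizeY_kernel : (2 < sizeY K)%N = ~~ [&& d (-1) 1 == 0, d 0 1 == 0 & d 1 1 == 0].
Proof.
have tN0 := gt_eqF t0; have E i : (toC (t * d i 1) == 0) = (d i 1 == 0).
  by rewrite fmorph_eq0 mulf_eq0 tN0.
rewrite ltnNge sizeYE; congr (~~ _); apply/idP/and3P => [sK|[/eqP e0 /eqP e1 /eqP e2]].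
  have K2 i : K`_i`_2 = 0 by rewrite -coef_swapXY [(swapXY K)`_2]nth_default ?coef0.
  have := K2 0%N; have := K2 1%N; have := K2 2%N; rewrite !coef_xquad /=.
  rewrite /kernel_a /kernel_b /kernel_c coefB !coefN coefX !coef_map_weight_row /= sub0r.
  by move=> /eqP + /eqP + /eqP; rewrite !oppr_eq0 !E.
apply/leq_sizeP => j j2; apply/polyP=> i; rewrite coef_swapXY coef0.
move: j2; rewrite leq_eqVlt => /orP[/eqP<-|j3]; last first.
  by rewrite nth_default // (leq_trans (size_coef_kernel i)).
rewrite coef_xquad; case: i => [|[|[|i]]] /=; rewrite ?coef0 //.
- by rewrite coefN coef_map_weight_row /= e0 mulr0 rmorph0 oppr0.
- by rewrite coefB coefX coef_map_weight_row /= e1 mulr0 rmorph0 subr0.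
- by rewrite coefN coef_map_weight_row /= e2 mulr0 rmorph0 oppr0.
Qed.

Lemma sizeY_kernel_le : (sizeY K <= 3)%N.
Proof. by apply/bigmax_leqP => i _; apply: size_coef_kernel. Qed.

Lemma boundary_corner_nondegenerate :
  boundary_steps -> corner_steps -> nondegenerate_model d t.
Proof.
move=> bd cn; have [sD sepD _] := real_disc_separable bd cn; have [nW nE nS nN] := bd.
have c0 : kernel_c != 0.
  by rewrite kernel_c_eq0; apply/negP => /and3P[/eqP E1 /eqP E2 /eqP E3]; apply: nE.
rewrite /nondegenerate_model /degenerate_model kernel_polyE => -[||].
- apply: separable_irreducible => //; rewrite xdisc_kernel ?size_map_poly //.
  by rewrite separable_map.
- by rewrite size_xquad.
- rewrite leqNgt; apply/negP; rewrite negbK ltn_predRL sizeY_kernel.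
  by apply/negP => /and3P[/eqP E1 /eqP E2 /eqP E3]; apply: nN.
Qed.

(** Without steps on the left side [x] divides [K], and without steps on the lower
    side [y] divides [K]; without steps on the right or upper side, [K] has degree
    at most one in [x] or in [y]. *)
Lemma nondegenerate_kernel : nondegenerate_model d t ->
  [/\ kernel_c != 0, ~ reducible K, sizeY K = 3%N & boundary_steps].
Proof.
rewrite /nondegenerate_model /degenerate_model kernel_polyE => nondeg.
have irr : ~ reducible K by move=> r; apply: nondeg; constructor 1.
have c0 : kernel_c != 0.
  apply/eqP => c0; apply: nondeg; constructor 2; rewrite c0 /xquad polyC0 mul0r addr0.
  suff s2 : (size (kernel_a%:P + kernel_b%:P * 'X)%R <= 2)%N.
    by case: (size _) s2.
  apply: leq_trans (size_polyD _ _) _; rewrite geq_max (leq_trans (size_polyC_leq1 _)) //=.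
  have [->|b0] := eqVneq kernel_b 0; first by rewrite mul0r size_poly0.
  by rewrite size_mulX ?polyC_eq0 // size_polyC b0.
have sY : (2 < sizeY K)%N.
  by rewrite ltnNge; apply/negP => sY; apply: nondeg; constructor 3; case: (sizeY K) sY.
split=> //; first by apply/eqP; rewrite eqn_leq sizeY_kernel_le.
split.
- move=> [E1 E2 E3]; apply: irr.
  have a0 : kernel_a = 0.
    apply/polyP=> j; rewrite /kernel_a coefN coef_map_weight_row E1 E2 E3 mulr0 rmorph0.
    by rewrite !if_same coef0 oppr0.
  exists 'X, (kernel_b%:P + kernel_c%:P * 'X); split.
  + by apply: nonunit_size; rewrite size_polyX.
  + apply: nonunit_size; rewrite addrC size_polyDl.
      by rewrite size_mulX ?polyC_eq0 // size_polyC c0.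
    by rewrite size_mulX ?polyC_eq0 // !size_polyC c0; case: (_ != 0).
  + by rewrite /xquad a0 polyC0; ring.
- move=> [E1 E2 E3]; move: c0; rewrite kernel_c_eq0 E1 E2 E3 eqxx //.
- move=> [E1 E2 E3]; apply: irr.
  have [|K' EK] := @dvd_XsubC_coefs _ 0 K.
    apply/polyP=> i; rewrite coef_map coef0 coef_xquad /= /horner_eval.
    case: i => [|[|[|i]]] /=; rewrite ?horner0 //.
    + by rewrite horner_coef0 coefN coef_map_weight_row /= E1 mulr0 rmorph0 oppr0.
    + by rewrite horner_coef0 coefB coefX coef_map_weight_row /= E2 mulr0 rmorph0 subr0.
    + by rewrite horner_coef0 coefN coef_map_weight_row /= E3 mulr0 rmorph0 oppr0.
  exists ('X - 0%:P)%:P, K'; split=> //.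
    by rewrite poly_unitE coefC eqxx poly_unitE size_XsubC !andbF.
  apply: nonunit_size; have <- : size K = size K'.
    by rewrite EK mul_polyC size_scale // polyXsubC_eq0.
  by rewrite size_xquad.
- by move=> [E1 E2 E3]; move: sY; rewrite sizeY_kernel E1 E2 E3 eqxx.
Qed.

Definition genus0_steps :=
        [\/ [/\ d (-1) 1 != 0, d 1 (-1) != 0
              & [/\ d (-1) (-1) = 0, d (-1) 0 = 0 & d 0 (-1) = 0]],
            [/\ d 1 1 != 0, d (-1) (-1) != 0
              & [/\ d (-1) 0 = 0, d (-1) 1 = 0 & d 0 1 = 0]],
            [/\ d (-1) 1 != 0, d 1 (-1) != 0
              & [/\ d 1 1 = 0, d 1 0 = 0 & d 0 1 = 0]]
          | [/\ d 1 1 != 0, d (-1) (-1) != 0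
              & [/\ d 1 0 = 0, d 1 (-1) = 0 & d 0 (-1) = 0]]].

(** The signs of the coordinates of the normal vector select the three
    forbidden steps; the two corners adjacent to them are then the only
    possible steps on one of the sides.  A normal vector along an axis leaves a
    side without steps. *)
Lemma half_plane_genus0_steps : boundary_steps ->
  in_half_plane R (step_set d) -> genus0_steps.
Proof.
move=> [nW nE nS nN] [a [b [ab H]]].
have z (i j : int) : i \in step_range -> j \in step_range ->
    a * i%:~R + b * j%:~R < 0 -> d i j = 0.
  move=> ir jr; rewrite ltNge => /negP neg; apply/eqP/negPn/negP => dij.
  by apply: neg; apply: H.
have zSW := z (-1) (-1) isT isT; have zW := z (-1) 0 isT isT; have zNW := z (-1) 1 isT isT.
have zS := z 0 (-1) isT isT; have zN := z 0 1 isT isT.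
have zSE := z 1 (-1) isT isT; have zE := z 1 0 isT isT; have zNE := z 1 1 isT isT.
rewrite /= !(mulrN1z, mulr1z, mulr0z) in zSW zW zNW zS zN zSE zE zNE.
have ne i j : (d i j = 0 -> False) -> d i j != 0 by move=> h; apply/eqP.
case: (ltgtP a 0) => a0; case: (ltgtP b 0) => b0.
- have E1 : d 1 1 = 0 by apply: zNE; lra.
  have E2 : d 1 0 = 0 by apply: zE; lra.
  have E3 : d 0 1 = 0 by apply: zN; lra.
  by constructor 3; split=> //; apply: ne => E4; [apply: nN|apply: nE].
- have E1 : d 1 0 = 0 by apply: zE; lra.
  have E2 : d 1 (-1) = 0 by apply: zSE; lra.
  have E3 : d 0 (-1) = 0 by apply: zS; lra.
  by constructor 4; split=> //; apply: ne => E4; [apply: nE|apply: nS].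
- by case: nE; split; [apply: zSE|apply: zE|apply: zNE]; lra.
- have E1 : d (-1) 0 = 0 by apply: zW; lra.
  have E2 : d (-1) 1 = 0 by apply: zNW; lra.
  have E3 : d 0 1 = 0 by apply: zN; lra.
  by constructor 2; split=> //; apply: ne => E4; [apply: nN|apply: nW].
- have E1 : d (-1) (-1) = 0 by apply: zSW; lra.
  have E2 : d (-1) 0 = 0 by apply: zW; lra.
  have E3 : d 0 (-1) = 0 by apply: zS; lra.
  by constructor 1; split=> //; apply: ne => E4; [apply: nW|apply: nS].
- by case: nW; split; [apply: zSW|apply: zW|apply: zNW]; lra.
- by case: nN; split; [apply: zNW|apply: zN|apply: zNE]; lra.
- by case: nS; split; [apply: zSW|apply: zS|apply: zSE]; lra.
- by case: ab; rewrite a0 b0.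
Qed.

Section Genus.
Variables (F : fieldType) (iota : {rmorphism C -> F}) (x y : F).
Hypothesis kf : kernel_field iota kernel_a kernel_b kernel_c x y.
Local Notation E i j := (iota (toC (t * d i j))).

Let relation : x * y =
  E (-1) (-1) + E (-1) 0 * y + E (-1) 1 * y ^+ 2 +
  (E 0 (-1) + E 0 0 * y + E 0 1 * y ^+ 2) * x +
  (E 1 (-1) + E 1 0 * y + E 1 1 * y ^+ 2) * x ^+ 2.
Proof.
have row i : peval iota y (map_poly toC (weight_row i)) =
    E i (-1) + E i 0 * y + E i 1 * y ^+ 2.
  rewrite map_weight_row !rmorphD /= !pevalZ pevalC pevalX.
  by rewrite rmorphXn /= pevalX.
have [_ _ _] := kf; rewrite /kernel_a /kernel_b /kernel_c rmorphB !rmorphN /= pevalX !row.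
move=> rel; rewrite -[LHS]subr0 -rel; ring.
Qed.

(** The four cases are exchanged by inverting [x] or [y], which moves the double
    point of the curve to the origin. *)
Lemma genus0_steps_genus0 : genus0_steps -> field_genus iota 0.
Proof.
have [ty xN gen _] := kf.
have y0 := transcendental_self_neq0 ty.
have x0 : x != 0.
  apply/eqP => x0; apply: xN; rewrite x0 -(rmorph0 (peval iota y)).
  exact: rational_in_peval.
have tN0 i j : d i j != 0 -> toC (t * d i j) != 0.
  by move=> dij; rewrite fmorph_eq0 mulf_neq0 // gt_eqF.
have E0 i j : d i j = 0 -> E i j = 0 by move=> ->; rewrite mulr0 !rmorph0.
have tyV := transcendentalV ty.
have xVN := not_rational_inVl xN.
case=> -[/tN0 d1 /tN0 d2 [/E0 e1 /E0 e2 /E0 e3]].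
- apply: (double_point_genus0 ty xN gen d2 d1 (B := toC (t * d 0 0)) (D := toC (t * d 1 0))
    (E := toC (t * d 0 1)) (G := toC (t * d 1 1))).
  by rewrite [LHS]relation e1 e2 e3; ring.
- apply: (double_point_genus0 tyV (not_rational_inVr xN) (generated_byVr gen) d1 d2
    (B := toC (t * d 0 0)) (D := toC (t * d 1 0)) (E := toC (t * d 0 (-1)))
    (G := toC (t * d 1 (-1)))).
  rewrite [LHS](_ : _ = x * y / y ^+ 2); last by field.
  by rewrite [X in X / _ = _]relation e1 e2 e3; field.
- apply: (double_point_genus0 tyV (not_rational_inVr xVN)
    (generated_byVl (generated_byVr gen)) d1 d2
    (B := toC (t * d 0 0)) (D := toC (t * d (-1) 0)) (E := toC (t * d 0 (-1)))
    (G := toC (t * d (-1) (-1)))).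
  rewrite [LHS](_ : _ = x * y / (x ^+ 2 * y ^+ 2)); last by field; rewrite x0 y0.
  by rewrite [X in X / _ = _]relation e1 e2 e3; field; rewrite x0 y0.
- apply: (double_point_genus0 ty xVN (generated_byVl gen) d2 d1
    (B := toC (t * d 0 0)) (D := toC (t * d (-1) 0)) (E := toC (t * d 0 1))
    (G := toC (t * d (-1) 1))).
  rewrite [LHS](_ : _ = x * y / x ^+ 2); last by field.
  by rewrite [X in X / _ = _]relation e1 e2 e3; field.
Qed.

Lemma boundary_corner_genus1 : boundary_steps -> corner_steps -> field_genus iota 1.
Proof.
move=> bd cn; have [sD sepD sepD'] := real_disc_separable bd cn; have [nW nE nS nN] := bd.
have [ty xN gen rel] := kf; have [_ PD PM PV] := rational_in_subfield iota y.
have c0 : kernel_c != 0.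
  by rewrite kernel_c_eq0; apply/negP => /and3P[/eqP E1 /eqP E2 /eqP E3]; apply: nE.
have cy0 := transcendental_neq0 ty c0.
have two0 := two_neq0 iota.
pose e := 2 * peval iota y kernel_c * x + peval iota y kernel_b.
have Ex : x = (e - peval iota y kernel_b) * (2 * peval iota y kernel_c)^-1.
  by rewrite /e; field; rewrite cy0 two0.
have sub2 P : subfield iota P -> P 2.
  by case=> PC _ _ _; rewrite -(rmorph_nat iota 2).
have subX P f : subfield iota P -> P y -> P f ->
    P ((f - peval iota y kernel_b) * (2 * peval iota y kernel_c)^-1).
  move=> sP Py Pf; have [_ QD QM QV] := sP.
  apply: (QM); first exact: (QD _ _ Pf (subfieldN sP (subfield_peval _ sP Py))).
  exact: (QV _ (QM _ _ (sub2 _ sP) (subfield_peval _ sP Py))).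
apply: (@double_cover_genus1 _ _ _ y e (map_poly toC real_disc)).
- split=> //; last by rewrite separable_map.
  + rewrite -xdisc_kernel /xdisc !(rmorphB, rmorphXn, rmorphM) /= rmorph_nat.
    rewrite [LHS](_ : _ = 4 * peval iota y kernel_c * (peval iota y kernel_c * x ^+ 2 +
      peval iota y kernel_b * x + peval iota y kernel_a) + (peval iota y kernel_b ^+ 2 -
      4 * peval iota y kernel_a * peval iota y kernel_c)); last by rewrite /e; ring.
    by rewrite rel mulr0 add0r /kernel_b rmorphB.
  + move=> r; apply: xN; rewrite Ex; apply: subX => //; first exact: rational_in_subfield.
    exact: rational_in_self.
  + move=> P sP Py Pe; apply: gen => //.
    by rewrite Ex; apply: subX.
- by rewrite size_map_poly size_quad_disc.
- by rewrite -map_revp separable_map.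
Qed.

End Genus.

Lemma kernel_field_model_genus g : nondegenerate_model d t ->
  (forall (F : fieldType) (iota : {rmorphism C -> F}) x y,
     kernel_field iota kernel_a kernel_b kernel_c x y -> field_genus iota g) ->
  model_genus d t g.
Proof.
move=> /nondegenerate_kernel[c0 irr sY _] genus.
have [F [iota [x [y kf]]]] := kernel_field_exists c0 irr.
exists F, iota; split; last exact: genus kf.
apply: (kernel_field_function_field c0 irr _ _ _ sY kernel_curveE kf).
- exact: size_kernel_a.
- exact: size_kernel_b.
- exact: size_kernel_c.
Qed.

Lemma model_genus_kernel_field g : nondegenerate_model d t -> model_genus d t g ->
  exists (F : fieldType) (iota : {rmorphism C -> F}) x y,
     kernel_field iota kernel_a kernel_b kernel_c x y /\ field_genus iota g.
Proof.
move=> /nondegenerate_kernel[c0 irr _ _] [F [iota [ff genus]]].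
have [x [y kf]] := generic_kernel_field c0 irr size_kernel_a size_kernel_b size_kernel_c
  kernel_curveE ff.
by exists F, iota, x, y.
Qed.

End Model.

Theorem corollary2p6 (R : realType) (d : int -> int -> R) (t : R)
  (d_itv : forall i j : int,
     i \in step_range -> j \in step_range -> 0 <= d i j <= 1)
  (d_sum : \sum_(i <- step_range) \sum_(j <- step_range) d i j = 1)
  (t_itv : 0 < t < 1)
  (t_transc : transcendental_over (weight_field d) t) :
  (nondegenerate_model d t ->
     (model_genus d t 0 <-> in_half_plane R (step_set d)) /\
     (model_genus d t 0 <->
        [\/ [/\ d (-1) 1 != 0, d 1 (-1) != 0
              & [/\ d (-1) (-1) = 0, d (-1) 0 = 0 & d 0 (-1) = 0]],
            [/\ d 1 1 != 0, d (-1) (-1) != 0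
              & [/\ d (-1) 0 = 0, d (-1) 1 = 0 & d 0 1 = 0]],
            [/\ d (-1) 1 != 0, d 1 (-1) != 0
              & [/\ d 1 1 = 0, d 1 0 = 0 & d 0 1 = 0]]
          | [/\ d 1 1 != 0, d (-1) (-1) != 0
              & [/\ d 1 0 = 0, d 1 (-1) = 0 & d 0 (-1) = 0]]]))
  /\
  (nondegenerate_model d t /\ model_genus d t 1 <-> ~ in_half_plane R (step_set d)).
Proof.
have steps_of_half : nondegenerate_model d t -> in_half_plane R (step_set d) -> genus0_steps d.
  move=> /(nondegenerate_kernel t_itv)[_ _ _ bd].
  exact: half_plane_genus0_steps.
have genus0 : nondegenerate_model d t -> genus0_steps d -> model_genus d t 0.
  move=> nondeg steps; apply: (kernel_field_model_genus t_itv nondeg) => F iota x y kf.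
  exact: (genus0_steps_genus0 t_itv kf).
have not_half_genus0 : nondegenerate_model d t -> model_genus d t 0 ->
    in_half_plane R (step_set d).
  move=> nondeg /(model_genus_kernel_field t_itv nondeg)[F [iota [x [y [kf g0]]]]].
  apply: contrapT => /not_half_plane[bd cn]; apply: (genus01_absurd g0).
  exact: (boundary_corner_genus1 d_itv d_sum t_itv kf).
split=> [nondeg|].
  split; split.
  - exact: not_half_genus0.
  - by move=> half; apply: genus0 => //; apply: steps_of_half.
  - by move=> g0; apply: steps_of_half => //; apply: not_half_genus0.
  - exact: genus0.
split=> [[nondeg g1] half|/not_half_plane[bd cn]].
  have [F [iota [x [y [kf g1']]]]] := model_genus_kernel_field t_itv nondeg g1.
  have g0 := genus0_steps_genus0 t_itv kf (steps_of_half nondeg half).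
  exact: genus01_absurd g0 g1'.
have nondeg := boundary_corner_nondegenerate d_itv d_sum t_itv bd cn.
split=> //; apply: (kernel_field_model_genus t_itv nondeg) => F iota x y kf.
exact: (boundary_corner_genus1 d_itv d_sum t_itv kf).
Qed.
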